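(* a) The fibers of the map $\theta:\mathcal X\to H_{\mathcal X}$ are the symplectic leaves of the Poisson space $\mathcal X$. That is, for every seed $\mathbf i$ and every point $h\in H_{\mathcal X}$ the fiber $\theta^{-1}(h)\subset\mathcal X_{\mathbf i}$ is a symplectic leaf of the Poisson torus $\mathcal X_{\mathbf i}$, and the birational isomorphisms between these fibers for different seeds, induced by the cluster transformations, respect the symplectic structures. b) In particular, the fibers of the map $\theta:\mathcal X(\mathbb R_{>0})\to H_{\mathcal X}(\mathbb R_{>0})$ are the symplectic leaves of the Poisson manifold $\mathcal X(\mathbb R_{>0})$.
   Context: A seed $\mathbf i=(\Lambda,(\ast,\ast),\{e_i\},\{d_i\})$ consists of a lattice $\Lambda$ (free abelian group of finite rank), a skew-symmetric $\mathbb Q$-valued bilinear form $(\ast,\ast)$ on it, a basis $\{e_i\}_{i\in I}$ of $\Lambda$ with a subset of frozen basis vectors (indexed by $I_0\subset I$), and positive integers $d_i$ with greatest common divisor $1$ such that $\varepsilon_{ij}:=(e_i,e_j)d_j\in\mathbb Z$ unless $i,j$ are both in $I_0$. Put $\widehat\varepsilon_{ij}=(e_i,e_j)$, and let $[\ast,\ast]$ be the bilinear form on $\Lambda$ with $[e_i,e_j]=\varepsilon_{ij}$. The mutation $\mu_k(\mathbf i)$, $k\in I\setminus I_0$, has the same $\Lambda$, $(\ast,\ast)$, $d$, and the basis $e'_k=-e_k$, $e'_i=e_i+\max(0,\varepsilon_{ik})e_k$ for $i\neq k$. The torus $\mathcal X_{\mathbf i}=\mathcal X_\Lambda=\mathrm{Hom}(\Lambda,\mathbb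 G_m)$ has coordinates $X_i$ (the characters given by $e_i$) and Poisson structure $\{X_i,X_j\}=\widehat\varepsilon_{ij}X_iX_j$. A mutation induces the birational map $$\mu_k^*X'_k=X_k^{-1},\qquad \mu_k^*X'_i=X_i(1+X_k^{-\mathrm{sgn}(\varepsilon_{ik})})^{-\varepsilon_{ik}}\ (i\ne k);$$ seed isomorphisms act by relabelling coordinates; cluster transformations are compositions of these. They preserve the Poisson structures. $\mathcal X$ denotes the collection of the tori $\mathcal X_{\mathbf i}$ for all seeds equivalent to a given one, glued by these birational maps; $\mathcal X(\mathbb R_{>0})$ is the manifold obtained by identifying the sets $\mathcal X_{\mathbf i}(\mathbb R_{>0})\cong\mathbb R_{>0}^I$ via the same maps (which are diffeomorphisms on positive points). $\mathrm{Ker}_L[\ast,\ast]=\{l\in\Lambda: [l,v]=0\ \forall v\in\Lambda\}$. $H_{\mathcal X}$ is the split torus with group of characters $\mathrm{Ker}_L[\ast,\ast]$, and $\theta:\mathcal X_\Lambda\to H_{\mathcal X}$ is the surjective homomorphism dual to the inclusion $\mathrm{Ker}_L[\ast,\ast]\subset\Lambda$; in coordinates, $\theta^*\chi_\alpha=\prod_iX_i^{\alpha_i}$ for $\alpha=\sum\alpha_ie_i\in \mathrm{Ker}_L[\ast,\ast]$. The maps $\theta$ commute with the cluster transformations of the $\mathcal X$-tori coming from mutations, so they give a map $\theta:\mathcal X\to H_{\mathcal X}$. *)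

(* Defs.v *)
From HB Require Import structures.
From Stdlib Require Import Relation_Operators.
From mathcomp Require Import all_boot all_order all_fingroup all_algebra.
From mathcomp Require Import all_classical all_reals all_analysis.
From mathcomp.real_closed Require Import complex.
From mathcomp Require Import ring.

Set Implicit Arguments.
Unset Strict Implicit.
Unset Printing Implicit Defensive.

Import Order.TTheory GRing.Theory Num.Theory.
Import numFieldNormedType.Exports.

Local Open Scope classical_set_scope.
Local Open Scope ring_scope.

(** * Seeds and mutations *)

(* The index set is 'I_n.  The existence of a basis makes the abelian group Lam
   free of rank n. *)
Record seed (Lam : zmodType) (n : nat) := Seed {
  form : Lam -> Lam -> rat;
  formDl : forall u v w, form (u + v) w = form u w + form v w;
  form_skew : forall u v, form u v = - form v u;
  basis : 'I_n -> Lam;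
  basisP : forall v,
    exists! c : 'rV[int]_n, v = \sum_(i < n) basis i *~ c 0 i;
  frozen : {set 'I_n};
  dmul : 'I_n -> nat;
  dmul_gt0 : forall i, (0 < dmul i)%N;
  dmul_gcd : \big[gcdn/0%N]_(i < n) dmul i = 1%N;
  eps_int : forall i j, ~~ ((i \in frozen) && (j \in frozen)) ->
    form (basis i) (basis j) * (dmul j)%:R \is a Num.int }.

Section SeedTheory.
Variables (Lam : zmodType) (n : nat) (s : seed Lam n).

Definition hateps (i j : 'I_n) : rat := form s (basis s i) (basis s j).

Definition eps (i j : 'I_n) : rat := hateps i j * (dmul s j)%:R.

(* [eps i j] as an integer; only meaningful unless i and j are both frozen. *)
Definition epsz (i j : 'I_n) : int := Num.floor (eps i j).

Definition coord (v : Lam) : 'rV[int]_n := sval (cid (basisP s v)).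

(* [bracket (basis s i) (basis s j) = eps i j], extended bilinearly *)
Definition bracket (u v : Lam) : rat :=
  \sum_(i < n) \sum_(j < n)
    (coord u 0 i)%:~R * (coord v 0 j)%:~R * eps i j.

Definition KerL : set Lam :=
  [set l | forall v : Lam, bracket l v = 0].

Lemma form0l u : form s (0 : Lam) u = 0.
Proof.
by apply: (addrI (form s (0 : Lam) u)); rewrite -formDl !addr0.
Qed.

Lemma formNl (u v : Lam) : form s (- u) v = - form s u v.
Proof. by apply: (addrI (form s u v)); rewrite -formDl !subrr form0l. Qed.

Lemma formMz (u v : Lam) (z : int) : form s (u *~ z) v = z%:~R * form s u v.
Proof.
have Hn (m : nat) : form s (u *+ m) v = m%:R * form s u v.
  elim: m => [|m IH]; first by rewrite mulr0n form0l mul0r.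
  by rewrite mulrS formDl IH -natr1 mulrDl mul1r addrC.
case: z => m; first exact: Hn.
by rewrite NegzE mulrNz formNl -pmulrn Hn mulrNz mulNr.
Qed.

Lemma formDr (u v w : Lam) : form s u (v + w) = form s u v + form s u w.
Proof. by rewrite form_skew formDl opprD -!(form_skew s u). Qed.

Lemma formNr (u v : Lam) : form s u (- v) = - form s u v.
Proof. by rewrite form_skew formNl -form_skew. Qed.

Lemma formMzr (u v : Lam) (z : int) :
  form s u (v *~ z) = z%:~R * form s u v.
Proof. by rewrite form_skew formMz -mulrN -form_skew. Qed.

Lemma form_id (u : Lam) : form s u u = 0.
Proof.
by have /eqP := form_skew s u u; rewrite -addr_eq0 -mulr2n mulrn_eq0 => /eqP.
Qed.

Section Mutation.
Variables (k : 'I_n) (hk : k \notin frozen s).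

Definition mut_basis (i : 'I_n) : Lam :=
  if i == k then - basis s k
  else basis s i + basis s k *~ Num.max 0 (epsz i k).

Let tc (c : 'rV[int]_n) : 'rV[int]_n :=
  \row_i if i == k then
           - c 0 k + \sum_(j | j != k) Num.max 0 (epsz j k) * c 0 j
         else c 0 i.

Let tcN c j : j != k -> tc c 0 j = c 0 j.
Proof. by move=> jk; rewrite mxE (negbTE jk). Qed.

Let tck c : tc c 0 k =
  - c 0 k + \sum_(j | j != k) Num.max 0 (epsz j k) * c 0 j.
Proof. by rewrite mxE eqxx. Qed.

Let tcK c : tc (tc c) = c.
Proof.
apply/rowP => i; have [->|ik] := eqVneq i k; last by rewrite !tcN.
rewrite tck [X in - X]tck opprD opprK -addrA -[RHS]addr0; congr (_ + _).
by rewrite (eq_bigr _ (fun j jk => congr1 _ (tcN c jk))) addNr.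
Qed.

Let tcE (c : 'rV[int]_n) : \sum_(i < n) mut_basis i *~ c 0 i =
            \sum_(i < n) basis s i *~ tc c 0 i.
Proof.
rewrite (bigD1 k) //= [RHS](bigD1 k) //= tck /mut_basis eqxx.
rewrite mulrzDr mulNrz mulrNz -addrA; congr (_ + _).
rewrite mulrz_sumr -big_split /=; apply: eq_bigr => j jk.
by rewrite (negbTE jk) tcN // mulrzDl addrC mulrzA.
Qed.

Lemma mut_basisP (v : Lam) :
  exists! c : 'rV[int]_n, v = \sum_(i < n) mut_basis i *~ c 0 i.
Proof.
have [c [vc uc]] := basisP s v.
exists (tc c); split; first by rewrite tcE tcK.
by move=> c'; rewrite tcE => /uc ->; rewrite tcK.
Qed.

Lemma mut_eps_int i j : ~~ ((i \in frozen s) && (j \in frozen s)) ->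
  form s (mut_basis i) (mut_basis j) * (dmul s j)%:R \is a Num.int.
Proof.
move=> fij.
pose m j : int := if j == k then - 2 else Num.max 0 (epsz j k).
have mE l : mut_basis l = basis s l + basis s k *~ m l.
  rewrite /mut_basis /m; case: eqP => [->|//].
  by rewrite mulrNz -[2]/(1 + 1 : int) mulrzDr mulr1z opprD addrA subrr add0r.
have ek l : eps l k \is a Num.int by apply: eps_int; rewrite (negbTE hk) andbF.
have ke l : eps k l \is a Num.int by apply: eps_int; rewrite (negbTE hk).
rewrite !mE formDl !formDr !formMz !formMzr form_id !mulr0 addr0 !mulrDl.
rewrite !rpredD //; first exact: eps_int; last first.
  by rewrite -mulrA rpredM ?rpred_int //; exact: ke.
rewrite /m; case: eqVneq => [->|jk].
  by rewrite -mulrA rpredM ?rpred_int //; exact: ek.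
suff -> : (Num.max 0 (epsz j k))%:~R * form s (basis s i) (basis s k) *
    (dmul s j)%:R = Num.max 0 (- eps k j) * eps i k :> rat.
  by rewrite rpredM // maxEle; case: ifP => _; rewrite ?rpredN ?rpred0.
rewrite -[(_)%:~R]/((Num.max 0 (epsz j k))%:~R : rat).
have -> : (Num.max 0 (epsz j k))%:~R = Num.max 0 (eps j k) :> rat.
  rewrite -[in RHS](floorK (ek j)) /epsz !maxEle -[0 in RHS]/(0%:~R) ler_int.
  by case: ifP.
rewrite /eps /hateps -(mulNr (form s _ _)) -form_skew.
have h (d : nat) (x : rat) : Num.max 0 (x * d%:R) = Num.max 0 x * d%:R.
  by rewrite maxr_pMl ?ler0n // mul0r.
by rewrite !h; ring.
Qed.

Definition mutate : seed Lam n := {|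
  form := form s;
  formDl := formDl s;
  form_skew := form_skew s;
  basis := mut_basis;
  basisP := mut_basisP;
  frozen := frozen s;
  dmul := dmul s;
  dmul_gt0 := dmul_gt0 s;
  dmul_gcd := dmul_gcd s;
  eps_int := mut_eps_int |}.

End Mutation.
End SeedTheory.

(** * Cluster transformations *)

(* All seeds equivalent to a given one are taken in the same lattice Lam; a seed
   isomorphism is determined by the matching of the two bases. *)
Record seed_iso (Lam : zmodType) (n : nat) (s t : seed Lam n) := SeedIso {
  iso_perm : {perm 'I_n};
  iso_frozen : forall i, (iso_perm i \in frozen t) = (i \in frozen s);
  iso_dmul : forall i, dmul t (iso_perm i) = dmul s i;
  iso_form : forall i j, hateps t (iso_perm i) (iso_perm j) = hateps s i j }.

Inductive cluster_path (Lam : zmodType) (n : nat) (s : seed Lam n) :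
    seed Lam n -> Type :=
| cp_id : cluster_path s s
| cp_mut t (c : cluster_path s t) k (hk : k \notin frozen t) :
    cluster_path s (mutate hk)
| cp_iso t u (c : cluster_path s t) (f : seed_iso t u) : cluster_path s u.

Arguments cp_id {Lam n} s.

(* The isomorphism of lattices underlying a cluster transformation: a mutation
   keeps the lattice, a seed isomorphism matches the two bases. *)
Fixpoint path_lattice (Lam : zmodType) (n : nat) (s t : seed Lam n)
    (c : cluster_path s t) : Lam -> Lam :=
  match c in cluster_path _ t return Lam -> Lam with
  | cp_id => id
  | cp_mut t c k hk => path_lattice c
  | cp_iso t u c f => fun v =>
      \sum_(i < n) basis u (iso_perm f i) *~ coord t (path_lattice c v) 0 i
  end.

Section Transformations.
Variable K : numFieldType.

(* A K-point of the torus Hom(Lam, G_m) is given by the row vector of its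
   coordinates X_i, its values on [basis s i]. *)
Definition torus (n : nat) : set 'rV[K]_n := [set x | forall i, x 0 i != 0].

Definition positive (n : nat) : set 'rV[K]_n := [set x | forall i, 0 < x 0 i].

Definition mut_map (Lam : zmodType) (n : nat) (s : seed Lam n) (k : 'I_n)
    (x : 'rV[K]_n) : 'rV[K]_n :=
  \row_i if i == k then (x 0 k)^-1
         else x 0 i * (1 + x 0 k ^ (- sgz (epsz s i k))) ^ (- epsz s i k).

Definition iso_map (Lam : zmodType) (n : nat) (s t : seed Lam n)
    (f : seed_iso s t) (x : 'rV[K]_n) : 'rV[K]_n :=
  \row_j x 0 ((iso_perm f)^-1%g j).

Fixpoint path_map (Lam : zmodType) (n : nat) (s t : seed Lam n)
    (c : cluster_path s t) : 'rV[K]_n -> 'rV[K]_n :=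
  match c with
  | cp_id => id
  | cp_mut t c k hk => mut_map t k \o path_map c
  | cp_iso t u c f => iso_map f \o path_map c
  end.

(* The points of the torus at which the composition is defined step by step. *)
Fixpoint path_dom (Lam : zmodType) (n : nat) (s t : seed Lam n)
    (c : cluster_path s t) : set 'rV[K]_n :=
  match c with
  | cp_id => @torus n
  | cp_mut t c k hk => path_dom c `&`
      [set x | forall i, i != k ->
        1 + path_map c x 0 k ^ (- sgz (epsz t i k)) != 0]
  | cp_iso t u c f => path_dom c
  end.

End Transformations.

Arguments path_map K {Lam n s t} c.
Arguments path_dom K {Lam n s t} c.

(** * Poisson spaces and symplectic leaves *)

(* A space with coordinate charts valued in K^n (K the real or the complex
   numbers); [at_coord c p x] means that the point p lies in the chart c and has
   coordinates x there, and [bivec c x i j] is the bracket of the coordinate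
   functions x_i and x_j at x. *)
Record poisson_space (K : numFieldType) (n : nat) := PoissonSpace {
  point : Type;
  chart : Type;
  at_coord : chart -> point -> 'rV[K]_n -> Prop;
  bivec : chart -> 'rV[K]_n -> 'M[K]_n }.

Section Leaves.
Variables (K : numFieldType) (n : nat).
Implicit Types (f : 'rV[K]_n -> K) (U : set 'rV[K]_n).

Definition partial (i : 'I_n) f : 'rV[K]_n -> K :=
  fun x => 'D_(delta_mx 0 i) f x.

Fixpoint Ck (m : nat) U f : Prop :=
  match m with
  | 0%N => forall x, U x -> {for x, continuous f}
  | m.+1 => (forall i x, U x -> derivable f x (delta_mx 0 i)) /\
            (forall i, Ck m U (partial i f))
  end.

(* Over the complex numbers this says that f is holomorphic on the open set
   U. *)
Definition smooth_on U f := forall m, Ck m U f.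

Definition grad f (x : 'rV[K]_n) : 'rV[K]_n := \row_i partial i f x.

(* The map from covectors to vectors is a |-> a *m Pi, so that the j-th entry
   below is the bracket of f with the j-th coordinate. *)
Definition ham_field (Pi : 'rV[K]_n -> 'M[K]_n) f (x : 'rV[K]_n) : 'rV[K]_n :=
  grad f x *m Pi x.

(* p and q lie on one integral curve, contained in a chart, of the Hamiltonian
   vector field of a smooth function defined on an open subset of that chart.
   The time t runs over a ball of K: over the complex numbers, integral curves
   are holomorphic in a complex time. *)
Definition ham_segment (P : poisson_space K n) (p q : point P) : Prop :=
  exists (c : chart P) (U : set 'rV[K]_n) (f : 'rV[K]_n -> K)
         (a r : K) (g : K -> 'rV[K]_n),
    [/\ open U,
        U `<=` [set x | exists p', at_coord c p' x],
        smooth_on U f,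
        forall t, ball a r t ->
          U (g t) /\ is_derive t 1 g (ham_field (bivec c) f (g t)) &
        exists t0 t1, [/\ ball a r t0, ball a r t1,
          at_coord c p (g t0) & at_coord c q (g t1)]].

(* Symplectic leaves: the classes of points that can be joined by a finite chain
   of Hamiltonian integral curves. *)
Definition symplectic_leaf (P : poisson_space K n) (L : set (point P)) : Prop :=
  exists p, (exists c x, at_coord c p x) /\
    L = [set q | clos_refl_trans _ (@ham_segment P) p q].

(* The tangent space of the leaf through a point with bivector A is the row
   space of A; its symplectic form takes (a *m A, b *m A) to the value of the
   bivector on the covectors a and b. *)
Definition leaf_form (A : 'M[K]_n) (v w : 'rV[K]_n) : K :=
  (v *m pinvmx A *m A *m (w *m pinvmx A)^T) 0 0.

End Leaves.

Arguments symplectic_leaf {K n} P L.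

(** * The cluster tori and the map theta *)

Section Theta.
Variables (K : numFieldType) (Lam : zmodType) (n : nat).

Definition seed_bivec (s : seed Lam n) (x : 'rV[K]_n) : 'M[K]_n :=
  \matrix_(i, j) (ratr (hateps s i j) * x 0 i * x 0 j).

Definition torus_space (s : seed Lam n) : poisson_space K n := {|
  point := 'rV[K]_n;
  chart := unit;
  at_coord := fun _ p x => p = x /\ torus x;
  bivec := fun _ => seed_bivec s |}.

Definition character (s : seed Lam n) (v : Lam) (x : 'rV[K]_n) : K :=
  \prod_(i < n) x 0 i ^ coord s v 0 i.

(* The K-points of the torus with character group KerL s: homomorphisms from
   KerL s to K^*.  The values of h outside KerL s are irrelevant. *)
Definition H_point (s : seed Lam n) (h : Lam -> K) : Prop :=
  (forall a, KerL s a -> h a != 0) /\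
  (forall a b, KerL s a -> KerL s b -> h (a + b) = h a * h b).

Definition H_positive (s : seed Lam n) (h : Lam -> K) : Prop :=
  H_point s h /\ (forall a, KerL s a -> 0 < h a).

Definition theta_fiber (s : seed Lam n) (h : Lam -> K) : set 'rV[K]_n :=
  [set x | torus x /\ forall a, KerL s a -> character s a x = h a].

(* The kernel of the differential of theta. *)
Definition fiber_tangent (s : seed Lam n) (x : 'rV[K]_n) : set 'rV[K]_n :=
  [set v | forall a : Lam, KerL s a -> 'D_v (character s a) x = 0].

Definition fiber_birational (s t : seed Lam n) (c : cluster_path s t)
    (h : Lam -> K) (h' : Lam -> K) : Prop :=
  let D := theta_fiber s h `&` path_dom K c in
  [/\ path_map K c @` D `<=` theta_fiber t h',
      set_inj D (path_map K c),
      theta_fiber s h `<=` closure D &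
      theta_fiber t h' `<=` closure (path_map K c @` D)].

Definition fiber_symplectic (s t : seed Lam n) (c : cluster_path s t)
    (h : Lam -> K) : Prop :=
  forall x, theta_fiber s h x -> path_dom K c x ->
    let y := path_map K c x in
    [/\ differentiable (path_map K c) x,
        'd (path_map K c) x @` fiber_tangent s x = fiber_tangent t y &
        forall v w, fiber_tangent s x v -> fiber_tangent s x w ->
          leaf_form (seed_bivec t y)
            ('d (path_map K c) x v) ('d (path_map K c) x w)
          = leaf_form (seed_bivec s x) v w].

End Theta.

(** * The manifold of positive points *)

Section Positive.
Variables (R : realType) (Lam : zmodType) (n : nat) (s : seed Lam n).

(* There is one chart for each path of mutations and isomorphisms starting at s,
   rather than one for each seed: gluing a torus to itself along a nontrivial
   seed automorphism would not be compatible with theta. *)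
Record chart_point := ChartPoint {
  cp_end : seed Lam n;
  cp_path : cluster_path s cp_end;
  cp_coord : 'rV[R]_n;
  cp_pos : positive cp_coord }.

Inductive glue_step : chart_point -> chart_point -> Prop :=
| glue_mut t (c : cluster_path s t) k (hk : k \notin frozen t) x
    (hx : positive x) (hx' : positive (mut_map t k x)) :
    glue_step (ChartPoint c hx) (ChartPoint (cp_mut c hk) hx')
| glue_iso t u (c : cluster_path s t) (f : seed_iso t u) x
    (hx : positive x) (hx' : positive (iso_map f x)) :
    glue_step (ChartPoint c hx) (ChartPoint (cp_iso c f) hx').

Definition glue_class (q : chart_point) : set chart_point :=
  [set q' | clos_refl_sym_trans _ glue_step q q'].

(* The quotient of the disjoint union of the charts by the equivalence relation
   generated by [glue_step]. *)
Definition X_positive : Type :=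
  {C : set chart_point | exists q, C = glue_class q}.

Definition X_class (q : chart_point) : X_positive :=
  exist _ (glue_class q) (ex_intro _ q erefl).

Definition X_repr (p : X_positive) : chart_point := sval (cid (svalP p)).

Definition X_positive_space : poisson_space R n := {|
  point := X_positive;
  chart := {t : seed Lam n & cluster_path s t};
  at_coord := fun c p x =>
    exists hx : positive x, p = X_class (ChartPoint (projT2 c) hx);
  bivec := fun c => seed_bivec (projT1 c) |}.

(* The character a of H composed with theta; it does not depend on the
   representative of p. *)
Definition theta_positive (p : X_positive) (a : Lam) : R :=
  let q := X_repr p in
  character (cp_end q) (path_lattice (cp_path q) a) (cp_coord q).

Definition theta_positive_fiber (h : Lam -> R) : set X_positive :=
  [set p | forall a, KerL s a -> theta_positive p a = h a].

End Positive.

(* Main.v *)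
From HB Require Import structures.
From Stdlib Require Import Relation_Operators.
From mathcomp Require Import all_boot all_order all_fingroup all_algebra.
From mathcomp Require Import all_classical all_reals all_analysis.
From mathcomp.real_closed Require Import complex.
From mathcomp Require Import ring.
Require Import Defs.

Set Implicit Arguments.
Unset Strict Implicit.
Unset Printing Implicit Defensive.

Import Order.TTheory GRing.Theory Num.Theory.
Import numFieldNormedType.Exports.

Local Open Scope classical_set_scope.
Local Open Scope ring_scope.

(** Since [e_i, e_j] = (e_i, e_j) d_j with d_j <> 0, the lattice Ker_L is the
    kernel of the skew form itself. Everything below is governed by its Gram
    matrix H. In the logarithmic coordinates log x_i the bivector is the
    constant matrix H, so Hamiltonian vectors form the row space of H; the
    characters in Ker_L are the exponentials of the integral linear forms that
    kill this row space, and they span all such forms because H is rational.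
    So the tangent spaces of the fibers of theta are the Hamiltonian
    directions ([fiber_tangentP]) and the characters in Ker_L are constant
    along Hamiltonian curves ([character_ham_derive], and constancy of
    functions with zero derivative on a ball).

    For the converse, the coordinate function x_j is constant along its own
    flow, which is therefore x_i -> x_i exp(tau H_ji) with tau arbitrary
    ([ham_segment_flow]). Composing these flows, a point y can be reached from
    x as soon as y / x = exp(tau H) for some vector tau. That every y in the
    fiber of x has this form is the connectedness of the fibers, hence rests
    on Ker_L being saturated; it is obtained from a Smith normal form of an
    integral multiple of H ([kernel_exp_image]): in the adapted monomial
    coordinates the entries of y / x along the kernel are 1, and only the
    other ones need a logarithm. The same coordinates extend any homomorphism
    on Ker_L to a point of the torus, so no fiber is empty
    ([theta_fiber_nonempty]). The argument is written for a field with an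
    exponential, so that it applies to the complex tori and to the positive
    points at the same time.

    A mutation is, uniformly in i, the map
    x_i -> x_i x_k^(m_i) (1 + x_k)^(- eps_ik), where e'_i = e_i + m_i e_k.
    The exponents of 1 + x_k cancel for characters in Ker_L
    ([character_mut]), and in logarithmic coordinates the differential is the
    identity plus a matrix of rank one, which sends the bivector to the
    bivector ([poisson_at_mut]). A linear map sending bivector to bivector
    preserves leaves and their forms ([poisson_at_leaf]). Domains and images
    are dense in the fibers because the condition 1 + x_k <> 0 can be restored
    by a small Hamiltonian flow inside the fiber ([fiber_perturb]), and
    cluster transformations are open ([path_open]).

    On positive points every cluster transformation is a bijection, so the
    initial chart is a global one for the glued manifold, and part b) reduces
    to a computation in that chart ([positive_leafE]). *)

(** * Monomials *)

Section Monomials.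
Variables (K : fieldType) (n : nat).
Implicit Types (x y z : 'rV[K]_n) (c d : 'rV[int]_n).

Definition mono x c : K := \prod_(i < n) x 0 i ^ c 0 i.

(** The endomorphism of the torus given by an integer matrix acting on
    exponents, so that composition is matrix multiplication, as in
    [mono_mono_row]. *)
Definition mono_row x (A : 'M[int]_n) : 'rV[K]_n := \row_i mono x (row i A).

Lemma mono0 x : mono x 0 = 1.
Proof. by rewrite /mono big1 // => i _; rewrite mxE expr0z. Qed.

Lemma mono_neq0 x c : (forall i, x 0 i != 0) -> mono x c != 0.
Proof. by move=> x0; apply/prodf_neq0 => i _; rewrite expfz_neq0. Qed.

Lemma monoD x c d : (forall i, x 0 i != 0) ->
  mono x (c + d) = mono x c * mono x d.
Proof.
move=> x0; rewrite /mono -big_split /=.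
by apply: eq_bigr => i _; rewrite mxE expfzDr.
Qed.

Lemma monoMl x y z c : (forall i, z 0 i = x 0 i * y 0 i) ->
  mono z c = mono x c * mono y c.
Proof.
move=> zE; rewrite /mono -big_split /=.
by apply: eq_bigr => i _; rewrite zE expfzMl.
Qed.

Lemma mono_sum (I : finType) x (F : I -> 'rV[int]_n) :
  (forall i, x 0 i != 0) ->
  mono x (\sum_i F i) = \prod_i mono x (F i).
Proof.
move=> x0; apply: (big_morph (mono x) _ (mono0 x)) => c d; exact: monoD.
Qed.

Lemma monoZ x c (m : int) : mono x (m *: c) = mono x c ^ m.
Proof.
rewrite /mono (big_morph (fun y : K => y ^ m)
  (fun y z : K => expfzMl y z m) (exp1rz _ m)).
by apply: eq_bigr => i _; rewrite mxE mulrC exprz_exp.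
Qed.

Lemma mono_delta x i : mono x (delta_mx 0 i) = x 0 i.
Proof.
rewrite /mono (bigD1 i) //= mxE !eqxx expr1z big1 ?mulr1 // => j ji.
by rewrite mxE (negbTE ji) andbF expr0z.
Qed.

Lemma mono_mono_row x (A : 'M[int]_n) c : (forall i, x 0 i != 0) ->
  mono (mono_row x A) c = mono x (c *m A).
Proof.
move=> x0; rewrite mulmx_sum_row mono_sum // [LHS]/mono.
by apply: eq_bigr => i _; rewrite mxE monoZ.
Qed.

Lemma mono_row_neq0 x A : (forall i, x 0 i != 0) ->
  forall i, mono_row x A 0 i != 0.
Proof. by move=> x0 i; rewrite mxE mono_neq0. Qed.

End Monomials.

(** * Integral kernels of rational matrices *)

Definition int_kernel n (H : 'M[rat]_n) (c : 'rV[int]_n) : Prop :=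
  map_mx intr c *m H = 0.

Lemma common_denominator m n (H : 'M[rat]_(m, n)) :
  exists2 N : int, N != 0 &
    exists M : 'M[int]_(m, n), N%:~R *: H = map_mx intr M.
Proof.
pose N := \prod_(i < m) \prod_(j < n) denq (H i j).
exists N.
  by apply/prodf_neq0 => i _; apply/prodf_neq0 => j _; exact: denq_neq0.
exists (\matrix_(i, j) Num.floor (N%:~R * H i j)).
apply/matrixP => i j; rewrite !mxE floorK //.
rewrite /N (bigD1 i) //= (bigD1 j) //= -mulrA rmorphM /= mulrAC.
have -> : (denq (H i j))%:~R * H i j = (numq (H i j))%:~R.
  by rewrite mulrC -{1}[H i j]divq_num_den divfK ?intr_eq0 ?denq_neq0.
by rewrite rpredM ?rpred_int.
Qed.

(** Write N H = L D R with D diagonal and put Z = {i | D_i = 0}. In the basis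
    given by L^-1 the integral kernel of H is the span of the vectors with
    index in Z, in particular a direct summand, and the image of H over any
    field is cut out by these same vectors. *)
Lemma smith_kernel n (H : 'M[rat]_n) :
  exists (L : 'M[int]_n) (Z : {set 'I_n}),
  [/\ L \in unitmx,
      forall i, i \in Z -> int_kernel H (row i (invmx L)),
      forall c, int_kernel H c -> forall i, i \notin Z -> (c *m L) 0 i = 0 &
      forall (K : numFieldType) (u : 'cV[K]_n),
        (forall i, i \in Z -> (map_mx intr (invmx L) *m u) i 0 = 0) ->
        exists t, u = map_mx ratr H *m t].
Proof.
have [N N0 [M HM]] := common_denominator H.
have [L uL [R uR [d _ ME]]] := int_Smith_normal_form M.
pose D : 'M[int]_n := diag_mx (\row_i d`_i).
have {}ME : M = L *m D *m R.
  by rewrite ME; congr (_ *m _ *m _); apply/matrixP => i j; rewrite !mxE.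
have kerP c : int_kernel H c <-> c *m M = 0.
  have N0' : N%:~R != 0 :> rat by rewrite intr_eq0.
  split=> [cH|cM].
    have : map_mx intr (c *m M) = 0 :> 'rV[rat]_n.
      by rewrite map_mxM -HM -scalemxAr cH scaler0.
    move=> /rowP cM0; apply/rowP => i; apply/eqP.
    by have /eqP := cM0 i; rewrite !mxE intr_eq0.
  rewrite /int_kernel -[LHS](scalerK N0') scalemxAr HM -map_mxM cM map_mx0.
  by rewrite scaler0.
exists L, [set i : 'I_n | d`_i == 0]%SET; split=> //.
- move=> i; rewrite inE => /eqP di; apply/kerP.
  rewrite -row_mul ME -!mulmxA mulKmx // row_mul.
  rewrite (_ : row i D = 0) ?mul0mx //.
  by apply/rowP => j; rewrite !mxE di mul0rn.
- move=> c /kerP; rewrite ME !mulmxA => cM i; rewrite inE => di.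
  have : c *m L *m D = 0 by rewrite -(mulmxK uR (_ *m D)) cM mul0mx.
  move=> /rowP/(_ i).
  rewrite mul_mx_diag [RHS]mxE [LHS]mxE [X in _ * X]mxE => /eqP.
  by rewrite mulf_eq0 (negbTE di) orbF => /eqP.
move=> K u hu.
pose f := fun p q (A : 'M[int]_(p, q)) => map_mx (intr : int -> K) A.
pose w : 'cV[K]_n := \col_i ((f _ _ (invmx L) *m u) i 0 / (d`_i)%:~R).
have fM : N%:~R *: map_mx ratr H = f _ _ M.
  apply/matrixP => i j; rewrite !mxE.
  move/matrixP/(_ i j): HM; rewrite !mxE => /(congr1 (@ratr K)).
  by rewrite rmorphM /= !ratr_int.
exists (N%:~R *: (f _ _ (invmx R) *m w)).
rewrite -scalemxAr scalemxAl fM ME /f !map_mxM -!mulmxA.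
rewrite [_ *m (_ *m w)]mulmxA -map_mxM mulmxV // map_mx1 mul1mx.
have -> : map_mx intr D *m w = f _ _ (invmx L) *m u.
  apply/colP => i; rewrite map_diag_mx mul_diag_mx !mxE.
  have [di|di] := eqVneq (d`_i) 0; last first.
    by rewrite mulrC divfK ?intr_eq0.
  rewrite di mul0r -[LHS](hu i) ?inE ?di // mxE.
  by apply: eq_bigr => j _; rewrite !mxE.
by rewrite mulmxA -map_mxM mulmxV // map_mx1 mul1mx.
Qed.

(** By the Smith form, the integral kernel is enough to cut out the row space,
    although u has entries in K. *)
Lemma kernel_annihilator (K : numFieldType) n (H : 'M[rat]_n) (u : 'rV[K]_n) :
  H^T = - H ->
  (forall c, int_kernel H c -> \sum_i (c 0 i)%:~R * u 0 i = 0) ->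
  exists t, u = t *m map_mx ratr H.
Proof.
move=> skewH uker; have [L [Z [_ LZ _ imH]]] := smith_kernel H.
have [|t ut] := imH K u^T.
  move=> i iZ; rewrite mxE -[RHS](uker _ (LZ i iZ)).
  by apply: eq_bigr => j _; rewrite !mxE.
exists (- t^T); apply: trmx_inj.
rewrite trmx_mul map_trmx skewH linearN /= trmxK map_mxN mulNmx mulmxN opprK.
exact: ut.
Qed.

(** An exponential is a homomorphism [ex] from the additive to the
    multiplicative group, so that the real and the complex cases are treated
    at once. *)
Section Exponential.
Variables (K : numFieldType) (ex : K -> K).
Hypotheses (ex0 : ex 0 = 1) (exD : forall u v, ex (u + v) = ex u * ex v).

Lemma hom_exp_neq0 u : ex u != 0.
Proof.
apply/eqP => u0; have /eqP := ex0.
by rewrite -(subrr u) exD u0 mul0r eq_sym oner_eq0.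
Qed.

Lemma hom_expMz u (m : int) : ex (m%:~R * u) = ex u ^ m.
Proof.
have nat_case (p : nat) : ex (p%:R * u) = ex u ^+ p.
  elim: p => [|p IH]; first by rewrite mul0r ex0.
  by rewrite -natr1 mulrDl mul1r exD IH exprSr.
case: m => p; first exact: nat_case.
rewrite NegzE mulrNz mulNr -pmulrn -exprnN -nat_case.
apply: (mulIf (hom_exp_neq0 (p.+1%:R * u))).
by rewrite -exD addNr ex0 mulVf // hom_exp_neq0.
Qed.

Lemma hom_exp_sum (I : finType) (F : I -> K) :
  ex (\sum_i F i) = \prod_i ex (F i).
Proof. by apply: (big_morph ex exD ex0). Qed.

(** This replaces taking a logarithm of z and correcting it by periods: in the
    coordinates of the Smith form, z has entries 1 along the kernel, whose
    logarithm can be taken to be 0, and the other logarithms are free. *)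
Lemma kernel_exp_image n (H : 'M[rat]_n) (z : 'rV[K]_n) :
  H^T = - H -> (forall i, z 0 i != 0) ->
  (forall c, exists u, ex u = mono z c) ->
  (forall c, int_kernel H c -> mono z c = 1) ->
  exists t : 'rV[K]_n, forall i, z 0 i = ex ((t *m map_mx ratr H) 0 i).
Proof.
move=> skewH z0 zlog zker; have [L [Z [uL LZ _ imH]]] := smith_kernel H.
pose z' := mono_row z (invmx L).
pose lg i := sval (cid (zlog (row i (invmx L)))).
have lgE i : ex (lg i) = z' 0 i.
  by rewrite /lg; case: cid => w /= ->; rewrite mxE.
pose u' : 'cV[K]_n := \col_i (if i \in Z then 0 else lg i).
have u'E i : ex (u' i 0) = z' 0 i.
  rewrite mxE; case: ifPn => iZ; last exact: lgE.
  by rewrite ex0 mxE zker //; exact: LZ.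
have [|t ut] := imH K (map_mx intr L *m u').
  by move=> i iZ; rewrite mulmxA -map_mxM mulVmx // map_mx1 mul1mx mxE iZ.
exists (- t^T) => i.
have -> : - t^T *m map_mx ratr H = (map_mx intr L *m u')^T.
  apply: trmx_inj; rewrite trmxK ut trmx_mul map_trmx skewH linearN /= trmxK.
  by rewrite map_mxN mulNmx mulmxN opprK.
rewrite mxE mxE hom_exp_sum.
under eq_bigr do rewrite mxE hom_expMz u'E.
transitivity (mono z' (row i L)).
  rewrite mono_mono_row // -row_mul mulmxV // rowE mulmx1.
  by rewrite mono_delta.
by apply: eq_bigr => j _; rewrite !mxE.
Qed.

End Exponential.

(** * The kernel of a seed *)

Section SeedKernel.
Variables (Lam : zmodType) (n : nat) (s : seed Lam n).
Implicit Types (u v a b : Lam) (c : 'rV[int]_n).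

Definition lincomb c : Lam := \sum_(i < n) basis s i *~ c 0 i.

Lemma coordK v : lincomb (coord s v) = v.
Proof. by rewrite /coord /lincomb; case: cid => c /= [<-]. Qed.

Lemma lincombK c : coord s (lincomb c) = c.
Proof.
by rewrite /coord; case: cid => d /= [dE du]; apply: du.
Qed.

Lemma lincombD c d : lincomb (c + d) = lincomb c + lincomb d.
Proof.
rewrite /lincomb -big_split /=; apply: eq_bigr => i _.
by rewrite mxE mulrzDr.
Qed.

Lemma lincomb0 : lincomb 0 = 0.
Proof. by rewrite /lincomb big1 // => i _; rewrite mxE mulr0z. Qed.

Lemma lincombZ (m : int) c : lincomb (m *: c) = lincomb c *~ m.
Proof.
rewrite /lincomb mulrz_suml; apply: eq_bigr => i _.
by rewrite mxE mulrC mulrzA.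
Qed.

Lemma lincomb_delta i : lincomb (delta_mx 0 i) = basis s i.
Proof.
rewrite /lincomb (bigD1 i) //= mxE !eqxx mulr1z big1 ?addr0 // => j ji.
by rewrite mxE (negbTE ji) andbF mulr0z.
Qed.

Lemma coordD u v : coord s (u + v) = coord s u + coord s v.
Proof.
by rewrite -[in LHS](coordK u) -[in LHS](coordK v) -lincombD lincombK.
Qed.

Lemma coord_basis i : coord s (basis s i) = delta_mx 0 i.
Proof. by rewrite -lincomb_delta lincombK. Qed.

Lemma form_lincomb c v :
  form s (lincomb c) v = \sum_i (c 0 i)%:~R * form s (basis s i) v.
Proof.
rewrite /lincomb.
rewrite (big_morph (form s ^~ v) (fun u w => formDl s u w v) (form0l s v)).
by apply: eq_bigr => i _; rewrite formMz.
Qed.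

Definition seed_form_mx : 'M[rat]_n := \matrix_(i, j) hateps s i j.

Lemma seed_form_mx_skew : seed_form_mx^T = - seed_form_mx.
Proof. by apply/matrixP => i j; rewrite !mxE [LHS]form_skew. Qed.

Lemma form_basisr v j :
  form s v (basis s j) = (map_mx intr (coord s v) *m seed_form_mx) 0 j.
Proof.
rewrite -[in LHS](coordK v) form_lincomb mxE.
by apply: eq_bigr => i _; rewrite !mxE.
Qed.

Lemma int_kernel_form a :
  int_kernel seed_form_mx (coord s a) <-> forall v, form s a v = 0.
Proof.
split=> [ak v|ak]; last first.
  by apply/rowP => j; rewrite -form_basisr ak mxE.
rewrite form_skew -(coordK v) form_lincomb big1 ?oppr0 // => i _.
by rewrite form_skew form_basisr ak mxE oppr0 mulr0.
Qed.

(** The multipliers d_j scale the columns of the matrix of the bracket by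
    nonzero numbers, so the left kernel is that of the skew form. *)
Lemma KerL_int_kernel a : KerL s a <-> int_kernel seed_form_mx (coord s a).
Proof.
have bE v : bracket s a v =
    \sum_j (coord s v 0 j)%:~R * (form s a (basis s j) * (dmul s j)%:R).
  rewrite /bracket exchange_big; apply: eq_bigr => j _ /=.
  rewrite -[in RHS](coordK a) form_lincomb mulr_suml mulr_sumr.
  by apply: eq_bigr => i _; rewrite /eps /hateps; ring.
split=> [ak|/int_kernel_form ak v]; last first.
  by rewrite bE big1 // => j _; rewrite ak mul0r mulr0.
apply/rowP => j; rewrite -form_basisr mxE.
have := ak (basis s j); rewrite bE (bigD1 j) //= coord_basis mxE !eqxx mul1r.
rewrite big1 ?addr0 => [/eqP|i ij]; last first.
  by rewrite mxE (negbTE ij) andbF mul0r.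
by rewrite mulf_eq0 pnatr_eq0 -leqn0 leqNgt dmul_gt0 orbF => /eqP.
Qed.

Lemma KerL_form a : KerL s a <-> forall v, form s a v = 0.
Proof. by rewrite KerL_int_kernel int_kernel_form. Qed.

Lemma KerLD a b : KerL s a -> KerL s b -> KerL s (a + b).
Proof.
by rewrite !KerL_form => a0 b0 v; rewrite formDl a0 b0 addr0.
Qed.

Lemma KerL0 : KerL s 0.
Proof. by rewrite KerL_form => v; rewrite form0l. Qed.

Lemma KerLMz a (m : int) : KerL s a -> KerL s (a *~ m).
Proof. by rewrite !KerL_form => a0 v; rewrite formMz a0 mulr0. Qed.

Section HPoint.
Variables (K : numFieldType) (h : Lam -> K).
Hypothesis hh : H_point s h.

Lemma H_point0 : h 0 = 1.
Proof.
have [h0 hD] := hh; apply: (mulIf (h0 0 KerL0)).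
by rewrite -hD ?addr0 ?mul1r //; exact: KerL0.
Qed.

Lemma H_pointMz a (m : int) : KerL s a -> h (a *~ m) = h a ^ m.
Proof.
move=> ak; have [h0 hD] := hh.
have nat_case (p : nat) : h (a *+ p) = h a ^+ p.
  elim: p => [|p IH]; first by rewrite H_point0.
  by rewrite mulrS hD ?IH ?exprS //; exact: (KerLMz (Posz p)).
case: m => p; first exact: nat_case.
have akp : KerL s (a *+ p.+1) by exact: (KerLMz (Posz p.+1)).
rewrite NegzE mulrNz -exprnN -nat_case; apply: (mulIf (h0 _ akp)).
by rewrite -hD // ?addNr ?H_point0 ?mulVf ?h0 //; exact: (KerLMz (- Posz p.+1)).
Qed.

Lemma H_point_sum (I : Type) (r : seq I) (F : I -> Lam) :
  (forall i, KerL s (F i)) ->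
  KerL s (\sum_(i <- r) F i) /\
  h (\sum_(i <- r) F i) = \prod_(i <- r) h (F i).
Proof.
move=> Fk; elim: r => [|i r [rk rE]].
  by rewrite !big_nil H_point0; split => //; exact: KerL0.
rewrite !big_cons -rE; split; first exact: KerLD.
exact: hh.2.
Qed.

(** The Smith form provides a complement to the kernel: a point is obtained by
    prescribing h on a basis of the kernel and 1 on the complement. *)
Lemma theta_fiber_nonempty : exists x : 'rV[K]_n,
  theta_fiber s h x /\ ((forall a, KerL s a -> 0 < h a) -> positive x).
Proof.
have [L [Z [uL LZ ZL _]]] := smith_kernel seed_form_mx.
(* Outside Z the value 0 makes h (r i) = 1. *)
pose r i := if i \in Z then lincomb (row i (invmx L)) else 0.
have rk i : KerL s (r i).
  rewrite /r; case: ifPn => [iZ|_]; last exact: KerL0.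
  by rewrite KerL_int_kernel lincombK; exact: LZ.
pose x' : 'rV[K]_n := \row_i h (r i).
have x'0 i : x' 0 i != 0 by rewrite mxE; apply: hh.1.
exists (mono_row x' L); split; last first.
  move=> hpos i; rewrite mxE; apply: prodr_gt0 => j _.
  by rewrite exprz_gt0 // mxE hpos.
split=> [i|a ak]; first exact: mono_row_neq0.
rewrite [LHS]mono_mono_row //.
have aE : a = \sum_i r i *~ (coord s a *m L) 0 i.
  rewrite -[LHS]coordK -[coord s a in LHS](mulmxK uL) mulmx_sum_row.
  rewrite (big_morph _ lincombD lincomb0); apply: eq_bigr => i _.
  rewrite lincombZ /r; case: ifPn => // iZ.
  by have /ZL -> := (KerL_int_kernel a).1 ak; rewrite // !mulr0z.
rewrite [in RHS]aE (H_point_sum _ _).2 => [|i]; last exact: KerLMz.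
by apply: eq_bigr => i _; rewrite H_pointMz // mxE.
Qed.

End HPoint.
End SeedKernel.

(** * Characters under mutations and isomorphisms *)

Section MutationAlgebra.
Variables (Lam : zmodType) (n : nat) (s : seed Lam n) (k : 'I_n).
Hypothesis hk : k \notin frozen s.

(** The exponent -2 at i = k turns e'_k = - e_k into e_k + m_k e_k, so that the
    basis vectors need no case distinction. *)
Definition mut_exp (i : 'I_n) : int :=
  if i == k then - 2 else Num.max 0 (epsz s i k).

Lemma mut_basisE i : mut_basis s k i = basis s i + basis s k *~ mut_exp i.
Proof.
rewrite /mut_basis /mut_exp; case: eqP => [->|//].
by rewrite mulrNz -[2]/(1 + 1 : int) mulrzDr mulr1z opprD addrA subrr add0r.
Qed.

Lemma epsz_eps i : (epsz s i k)%:~R = eps s i k.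
Proof. by rewrite floorK // eps_int // (negbTE hk) andbF. Qed.

Lemma epsz_self : epsz s k k = 0.
Proof.
apply/eqP; rewrite -(intr_eq0 rat) epsz_eps /eps /hateps form_id.
by rewrite mul0r.
Qed.

Lemma epsz_eq0 i : (epsz s i k == 0) = (hateps s i k == 0).
Proof.
rewrite -(intr_eq0 rat) epsz_eps /eps mulf_eq0 pnatr_eq0.
by rewrite -leqn0 leqNgt dmul_gt0 orbF.
Qed.

Lemma KerL_mutate a : KerL (mutate hk) a <-> KerL s a.
Proof. by rewrite !KerL_form. Qed.

Section Points.
Variable K : numFieldType.
Implicit Types x y : 'rV[K]_n.

Definition mut_dom x : Prop := forall i, i != k ->
  1 + x 0 k ^ (- sgz (epsz s i k)) != 0.

Let addVr_neq0 x : torus x -> 1 + x 0 k != 0 -> 1 + (x 0 k)^-1 != 0.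
Proof.
move=> tx x1; have -> : 1 + (x 0 k)^-1 = (1 + x 0 k) / x 0 k.
  by rewrite mulrDl mul1r mulfV ?tx // addrC.
by rewrite mulf_neq0 ?invr_neq0 ?tx.
Qed.

(** The second alternative covers x_k = -1 when the mutation does not involve
    1 + x_k at all. *)
Lemma mut_domP x : torus x ->
  mut_dom x <-> 1 + x 0 k != 0 \/ forall i, epsz s i k = 0.
Proof.
move=> tx; split=> [xd|xd i ik].
  case: (eqVneq (1 + x 0 k) 0) => x1; [right=> i | by left].
  have [->|ik] := eqVneq i k; first exact: epsz_self.
  have xk : x 0 k = -1 by apply/eqP; rewrite -addr_eq0 addrC x1.
  have := xd i ik; rewrite xk; case: (ltgtP (epsz s i k) 0) => [e|e|//].
    by rewrite ltr0_sgz // opprK expr1z subrr eqxx.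
  by rewrite gtr0_sgz // exprN1 invrN1 subrr eqxx.
have two0 : 1 + 1 != 0 :> K by rewrite -[1 + 1]/(2%:R) pnatr_eq0.
case: (ltgtP (epsz s i k) 0) => e; last by rewrite e sgz0 oppr0 expr0z.
  case: xd => [x1|e0]; last by rewrite e0 ltxx in e.
  by rewrite ltr0_sgz // opprK expr1z.
case: xd => [x1|e0]; last by rewrite e0 ltxx in e.
by rewrite gtr0_sgz // exprN1 addVr_neq0.
Qed.

(** Uniformly in i, including i = k: this is the action of the mutation on
    lattices, x_i -> x_i x_k^(m_i), followed by a birational automorphism that
    depends on 1 + x_k only. *)
Lemma mut_mapE x i : torus x -> mut_map s k x 0 i =
  x 0 i * x 0 k ^ mut_exp i * (1 + x 0 k) ^ (- epsz s i k).
Proof.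
move=> tx; rewrite mxE /mut_exp; case: eqVneq => [->|ik].
  rewrite epsz_self oppr0 expr0z mulr1 -[X in X * _]expr1z -expfzDr ?tx //.
rewrite -mulrA; congr (_ * _).
case: (ltgtP (epsz s i k) 0) => e.
- by rewrite ltr0_sgz // opprK expr1z expr0z mul1r.
- rewrite gtr0_sgz // exprN1.
  have -> : 1 + (x 0 k)^-1 = (1 + x 0 k) * (x 0 k)^-1.
    by rewrite mulrDl mul1r mulfV ?tx // addrC.
  by rewrite expfzMl exprz_inv opprK mulrC.
- by rewrite e oppr0 !expr0z mulr1.
Qed.

(** On the torus this is the mutation in direction k of the mutated seed,
    written with the exponents of the original one so that it inverts
    [mut_mapE] factor by factor. *)
Definition mut_inv y : 'rV[K]_n :=
  \row_i (y 0 i * (y 0 k)^-1 ^ (- mut_exp i) * (1 + (y 0 k)^-1) ^ epsz s i k).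

Lemma mut_invk y : torus y -> mut_inv y 0 k = (y 0 k)^-1.
Proof.
move=> ty; rewrite mxE epsz_self expr0z mulr1 /mut_exp eqxx opprK.
by rewrite -[X in X * _]expr1z exprz_inv -expfzDr ?ty // exprN1.
Qed.

Lemma mut_map_k x : mut_map s k x 0 k = (x 0 k)^-1.
Proof. by rewrite mxE eqxx. Qed.

Let cancel_power (z : K) (e : int) :
  z != 0 \/ e = 0 -> z ^ e * z ^ (- e) = 1.
Proof.
by case=> [z0|->]; rewrite ?oppr0 ?expr0z ?mulr1 // -expfzDr // subrr expr0z.
Qed.

Lemma mut_map_torus x : torus x -> mut_dom x -> torus (mut_map s k x).
Proof.
move=> tx xd i; rewrite mut_mapE // mulf_neq0 ?mulf_neq0 ?tx //.
  exact: expfz_neq0 (tx k).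
have [x1|->] := (mut_domP tx).1 xd; first exact: expfz_neq0.
by rewrite oppr0 expr0z oner_eq0.
Qed.

Lemma mut_mapK x : torus x -> mut_dom x -> mut_inv (mut_map s k x) = x.
Proof.
move=> tx xd; apply/rowP => i.
rewrite mxE mut_mapE // mut_map_k invrK.
have rearrange (a b b' c c' : K) :
    a * b * c * b' * c' = a * (b * b') * (c' * c).
  by ring.
rewrite rearrange !cancel_power ?mulr1 //; last by left; exact: tx.
by have [x1|e0] := (mut_domP tx).1 xd; [left | right].
Qed.

Definition mut_inv_dom y : Prop :=
  1 + (y 0 k)^-1 != 0 \/ forall i, epsz s i k = 0.

Lemma mut_inv_torus y : torus y -> mut_inv_dom y ->
  torus (mut_inv y) /\ mut_dom (mut_inv y).
Proof.
move=> ty yd; have tx : torus (mut_inv y).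
  move=> i; rewrite mxE mulf_neq0 ?mulf_neq0 ?ty //.
    by apply: expfz_neq0; rewrite invr_neq0 ?ty.
  by case: yd => [y1|->]; [exact: expfz_neq0 | rewrite expr0z oner_eq0].
by split=> //; apply/mut_domP => //; rewrite mut_invk.
Qed.

Lemma mut_invK y : torus y -> mut_inv_dom y -> mut_map s k (mut_inv y) = y.
Proof.
move=> ty yd; have [tx xd] := mut_inv_torus ty yd.
apply/rowP => i; rewrite mut_mapE // mut_invk // mxE.
have rearrange (a b b' c c' : K) :
    a * b' * c * b * c' = a * (b * b') * (c * c').
  by ring.
rewrite rearrange !cancel_power ?mulr1 //; last by left; rewrite invr_neq0 ?ty.
by case: yd => [|->]; [left | right].
Qed.

(** The monomial part of the mutation is the change of basis; what remains is
    1 + x_k to the power - sum_i c_i eps_ik, with c the coordinates of a in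
    the new basis, and this sum is a multiple of (a, e_k) = 0. *)
Lemma character_mut x a : torus x -> mut_dom x -> KerL s a ->
  character (mutate hk) a (mut_map s k x) = character s a x.
Proof.
move=> tx xd ak; set c := coord (mutate hk) a.
have aE : a = \sum_i (basis s i + basis s k *~ mut_exp i) *~ c 0 i.
  rewrite -[LHS](coordK (mutate hk)); apply: eq_bigr => i _.
  by rewrite /= mut_basisE.
have coordE : coord s a =
    \sum_i c 0 i *: (delta_mx 0 i + mut_exp i *: delta_mx 0 k).
  apply: (can_inj (lincombK s)); rewrite coordK [LHS]aE.
  rewrite (big_morph _ (lincombD s) (lincomb0 s)); apply: eq_bigr => i _.
  by rewrite lincombZ lincombD lincombZ !lincomb_delta.
have eps0 : \sum_i c 0 i * epsz s i k = 0.
  apply/eqP; rewrite -(intr_eq0 rat) rmorph_sum /=.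
  apply/eqP; transitivity (form s a (basis s k) * (dmul s k)%:R); last first.
    by rewrite (KerL_form s a).1 ?mul0r.
  rewrite [in form _ _ _]aE.
  rewrite (big_morph (form s ^~ _) (fun u w => formDl s u w _) (form0l s _)).
  rewrite mulr_suml; apply: eq_bigr => i _.
  rewrite rmorphM /= epsz_eps formMz formDl formMz form_id mulr0 addr0 /eps.
  by rewrite mulrA.
transitivity (mono x (coord s a)); last by [].
rewrite coordE mono_sum //.
transitivity (\prod_i
  (mono x (c 0 i *: (delta_mx 0 i + mut_exp i *: delta_mx 0 k))
  * (1 + x 0 k) ^ (- (c 0 i * epsz s i k)))).
  apply: eq_bigr => i _; rewrite mut_mapE // expfzMl monoZ monoD //.
  by rewrite mono_delta monoZ mono_delta exprz_exp mulNr [epsz _ _ _ * _]mulrC.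
rewrite big_split /= -[RHS]mulr1; congr (_ * _).
have [x1|e0] := (mut_domP tx).1 xd.
  rewrite -(big_morph (fun m : int => (1 + x 0 k) ^ m)
    (fun p q => expfzDr p q x1) (expr0z _)).
  by rewrite sumrN eps0 oppr0 expr0z.
by rewrite big1 // => i _; rewrite e0 mulr0 oppr0 expr0z.
Qed.

End Points.
End MutationAlgebra.

Section IsoAlgebra.
Variables (Lam : zmodType) (n : nat) (t u : seed Lam n) (f : seed_iso t u).

Definition iso_lattice (v : Lam) : Lam :=
  \sum_(i < n) basis u (iso_perm f i) *~ coord t v 0 i.

Lemma coord_iso v j :
  coord u (iso_lattice v) 0 j = coord t v 0 ((iso_perm f)^-1%g j).
Proof.
have -> : iso_lattice v = lincomb u (\row_j coord t v 0 ((iso_perm f)^-1%g j)).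
  rewrite /lincomb (reindex_inj (@perm_inj _ (iso_perm f))).
  by apply: eq_bigr => i _; rewrite mxE permK.
by rewrite lincombK mxE.
Qed.

Lemma KerL_iso v : KerL u (iso_lattice v) <-> KerL t v.
Proof.
rewrite !KerL_int_kernel /int_kernel.
have E j : (map_mx intr (coord u (iso_lattice v)) *m seed_form_mx u) 0
    (iso_perm f j) = (map_mx intr (coord t v) *m seed_form_mx t) 0 j.
  rewrite !mxE (reindex_inj (@perm_inj _ (iso_perm f))).
  by apply: eq_bigr => i _; rewrite !mxE coord_iso permK iso_form.
split=> H; apply/rowP => j; first by rewrite -E H !mxE.
by rewrite -[j](permKV (iso_perm f)) E H !mxE.
Qed.

Lemma iso_lattice_surj v : exists w, iso_lattice w = v.
Proof.
exists (lincomb t (\row_i coord u v 0 (iso_perm f i))).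
apply: (can_inj (coordK u)); apply/rowP => j.
by rewrite coord_iso lincombK mxE permKV.
Qed.

Lemma character_iso (K : numFieldType) (x : 'rV[K]_n) v :
  character u (iso_lattice v) (iso_map f x) = character t v x.
Proof.
rewrite /character (reindex_inj (@perm_inj _ (iso_perm f))).
by apply: eq_bigr => i _; rewrite coord_iso mxE permK.
Qed.

End IsoAlgebra.

Section PathAlgebra.
Variables (Lam : zmodType) (n : nat) (s : seed Lam n).

Lemma path_KerL t (c : cluster_path s t) a :
  KerL t (path_lattice c a) <-> KerL s a.
Proof.
elim: c => //= [t' c IH k hk|t' u c IH f]; first by rewrite KerL_mutate.
by rewrite -[X in KerL _ X]/(iso_lattice f _) KerL_iso.
Qed.

Lemma path_lattice_surj t (c : cluster_path s t) b :
  exists a, path_lattice c a = b.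
Proof.
elim: c b => //= [b|t' u c IH f b]; first by exists b.
have [d <-] := iso_lattice_surj f b; have [a <-] := IH d.
by exists a.
Qed.

Lemma path_character (K : numFieldType) t (c : cluster_path s t)
    (x : 'rV[K]_n) :
  path_dom K c x ->
  [/\ torus x, torus (path_map K c x) & forall a, KerL s a ->
    character t (path_lattice c a) (path_map K c x) = character s a x].
Proof.
elim: c => //= [t' c IH k hk [/IH[tx ty xa] yd]|t' u c IH f /IH[tx ty xa]].
  split=> // [|a ak]; first exact: mut_map_torus.
  by rewrite character_mut ?xa //; apply/path_KerL.
split=> // [j|a ak]; first by rewrite mxE.
by rewrite -[X in character u X]/(iso_lattice f _) character_iso xa.
Qed.

End PathAlgebra.

(** * Logarithmic derivatives *)

Section LogDiff.
Variables (K : numFieldType) (V : normedModType K).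
Implicit Types (f g : V -> K) (x v : V) (l : V -> K).

(** l is the differential of log f at x, without choosing a branch of log: it
    is additive on products and multiplied by m on m-th powers. *)
Definition logdiff f x l : Prop :=
  [/\ f x != 0, differentiable f x & forall v, 'd f x v = f x * l v].

Lemma logdiff_ext f x l l' : (forall v, l v = l' v) ->
  logdiff f x l -> logdiff f x l'.
Proof. by move=> ll [f0 df fE]; split=> // v; rewrite fE ll. Qed.

Lemma logdiff1 x : logdiff (fun=> 1) x (fun=> 0).
Proof.
split; [exact: oner_neq0 | exact: differentiable_cst|move=> v].
by rewrite diff_cst mulr0.
Qed.

Lemma logdiffM f g x l m : logdiff f x l -> logdiff g x m ->
  logdiff (fun y => f y * g y) x (fun v => l v + m v).
Proof.
move=> [f0 df fE] [g0 dg gE]; split; first by rewrite mulf_neq0.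
  exact: differentiableM.
move=> v; transitivity (f x * 'd g x v + g x * 'd f x v).
  by rewrite (diffM df dg).
by rewrite fE gE; ring.
Qed.

Lemma logdiffV f x l : logdiff f x l ->
  logdiff (fun y => (f y)^-1) x (fun v => - l v).
Proof.
move=> [f0 df fE]; split; first by rewrite invr_eq0.
  exact: differentiableV.
move=> v; transitivity (- f x ^- 2 * 'd f x v); first by rewrite (diffV df f0).
by rewrite fE; field.
Qed.

Lemma logdiffXz f x l (m : int) : logdiff f x l ->
  logdiff (fun y => f y ^ m) x (fun v => m%:~R * l v).
Proof.
move=> fl.
have nat_case (p : nat) : logdiff (fun y => f y ^+ p) x (fun v => p%:R * l v).
  elim: p => [|p IH].
    by apply: logdiff_ext (logdiff1 x) => v; rewrite mul0r.
  under eq_fun do rewrite exprS.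
  apply: logdiff_ext (logdiffM fl IH) => v.
  by rewrite -natr1 mulrDl mul1r addrC.
case: m => p; first exact: nat_case.
rewrite (_ : (fun y => _) = fun y => (f y ^+ p.+1)^-1) //.
apply: logdiff_ext (logdiffV (nat_case p.+1)) => v.
by rewrite NegzE mulrNz mulNr.
Qed.

Lemma logdiff_prod (I : Type) (r : seq I) (F : I -> V -> K) x
    (l : I -> V -> K) :
  (forall i, logdiff (F i) x (l i)) ->
  logdiff (fun y => \prod_(i <- r) F i y) x (fun v => \sum_(i <- r) l i v).
Proof.
move=> Fl; elim: r => [|i r IH].
  under eq_fun do rewrite big_nil.
  by apply: logdiff_ext (logdiff1 x) => v; rewrite big_nil.
under eq_fun do rewrite big_cons.
by apply: logdiff_ext (logdiffM (Fl i) IH) => v; rewrite big_cons.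
Qed.

Lemma logdiff_add1 f x l : logdiff f x l -> 1 + f x != 0 ->
  logdiff (fun y => 1 + f y) x (fun v => f x / (1 + f x) * l v).
Proof.
move=> [f0 df fE] f1; have dc : differentiable (fun=> 1 : K) x.
  exact: differentiable_cst.
split=> // [|v]; first exact: differentiableD.
transitivity ('d (fun=> 1 : K) x v + 'd f x v); first by rewrite (diffD dc df).
by rewrite diff_cst add0r fE; field.
Qed.

Lemma logdiff_derive f x l v : logdiff f x l -> 'D_v f x = f x * l v.
Proof. by move=> [_ df fE]; rewrite deriveE. Qed.

End LogDiff.

Section LogDiffRow.
Variables (K : numFieldType) (n : nat).
Implicit Types x v : 'rV[K]_n.

Lemma diff_coord x i v : 'd (fun y : 'rV[K]_n => y 0 i) x v = v 0 i.
Proof.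
pose f0 : 'rV[K]_n -> K := fun N => N 0 i.
have f0lin : linear f0 by move=> k u w; rewrite /f0 !mxE.
pose fM := GRing.isLinear.Build _ _ _ _ _ f0lin.
pose f : {linear 'rV[K]_n -> K} := HB.pack f0 fM.
by rewrite (@diff_lin _ _ _ f) //; exact: coord_continuous.
Qed.

Lemma logdiff_coord x i : x 0 i != 0 ->
  logdiff (fun y : 'rV[K]_n => y 0 i) x (fun v => v 0 i / x 0 i).
Proof.
move=> xi; split=> [//||v]; first exact: differentiable_coord.
by rewrite diff_coord mulrC divfK.
Qed.

Lemma logdiff_mono x (c : 'rV[int]_n) : torus x ->
  logdiff (fun y : 'rV[K]_n => mono y c) x
    (fun v => \sum_i (c 0 i)%:~R * (v 0 i / x 0 i)).
Proof.
move=> tx; apply: logdiff_prod => i.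
exact: logdiffXz (logdiff_coord (tx i)).
Qed.

End LogDiffRow.

Lemma differentiable_row (K : numFieldType) m (V : normedModType K)
    (f : V -> 'rV[K]_m) (p : V) :
  (forall i, differentiable (fun y => f y 0 i) p) ->
  differentiable f p /\
  forall (v : V) i, 'd f p v 0 i = 'd (fun y => f y 0 i) p v.
Proof.
move=> df.
have fE : f = \sum_(i < m) (fun y => f y 0 i *: delta_mx 0 i).
  apply/funext => y; rewrite [LHS]row_sum_delta.
  by elim/big_rec2: _ => // i g h _ ->.
have dF : differentiable f p.
  rewrite fE; apply: differentiable_sum => i; exact: differentiableZl.
split=> // v i; rewrite -(diff_coord (f p) i).
have dc := @differentiable_coord K _ _ (f p) 0 i.
by rewrite -[LHS]/((_ \o _) v) -(diff_comp dF dc).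
Qed.

(** * The Poisson bivector and its leaves at the level of tangent spaces *)

Section LinearSymplectic.
Variables (K : numFieldType) (n : nat).
Implicit Types (A P Q : 'M[K]_n) (a b : 'rV[K]_n).

(** Two preimages of b A under A differ by a covector that A kills, which
    pairs to zero with a A because A is skew; so the form does not depend on
    the choice made by the pseudo-inverse. *)
Lemma leaf_formE A a b : A^T = - A ->
  leaf_form A (a *m A) (b *m A) = (a *m A *m b^T) 0 0.
Proof.
move=> skewA; rewrite /leaf_form mulmxKpV ?submxMl //.
set b' := b *m A *m pinvmx A.
have b'A : b' *m A = b *m A by rewrite mulmxKpV ?submxMl.
have E c : a *m A *m c^T = - (a *m (c *m A)^T).
  by rewrite trmx_mul skewA mulNmx mulmxN opprK mulmxA.
by rewrite E b'A -E.
Qed.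

(** f is a local Poisson isomorphism at x: covectors are pulled back by J^T,
    and P, Q are the bivectors at x and at f x. *)
Definition poisson_at (f : 'rV[K]_n -> 'rV[K]_n) (x : 'rV[K]_n) P Q : Prop :=
  differentiable f x /\ exists2 J : 'M[K]_n, J \in unitmx &
    (forall v, 'd f x v = v *m J) /\ J^T *m P *m J = Q.

Lemma poisson_at_id x P : poisson_at id x P P.
Proof.
have [did idE] := is_diff_id x; split=> //.
exists 1%:M; first exact: unitmx1.
by split=> [v|]; rewrite ?idE ?trmx1 ?mulmx1 ?mul1mx.
Qed.

Lemma poisson_at_comp f g x P Q S :
  poisson_at f x P Q -> poisson_at g (f x) Q S -> poisson_at (g \o f) x P S.
Proof.
move=> [df [J uJ [fJ JPQ]]] [dg [J' uJ' [gJ JQS]]].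
split; first exact: differentiable_comp.
exists (J *m J'); first by rewrite unitmx_mul uJ.
split=> [v|].
  transitivity ('d g (f x) ('d f x v)); last first.
    by rewrite gJ fJ mulmxA.
  by have /(congr1 (@^~ v)) := diff_comp df dg.
by rewrite trmx_mul -JQS -JPQ !mulmxA.
Qed.

(** Both the image of the tangent space of a leaf and the symplectic form on it
    are read off from covectors: v = a P is sent to v J = (a J^{-T}) Q. *)
Lemma poisson_at_leaf f x P Q : P^T = - P -> poisson_at f x P Q ->
  [/\ differentiable f x,
      'd f x @` [set v | (v <= P)%MS] = [set v | (v <= Q)%MS] &
      forall v w, (v <= P)%MS -> (w <= P)%MS ->
        leaf_form Q ('d f x v) ('d f x w) = leaf_form P v w].
Proof.
move=> skewP [df [J uJ [fJ JPQ]]].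
have uJT : J^T \in unitmx by rewrite unitmx_tr.
have push a : a *m P *m J = a *m invmx J^T *m Q.
  by rewrite -JPQ !mulmxA mulmxKV.
split=> //.
  apply/seteqP; split=> [_ [v /submxP[a ->] <-]|w /submxP[a ->]] /=.
    by rewrite fJ push submxMl.
  exists (a *m J^T *m P); first exact: submxMl.
  by rewrite fJ push mulmxK.
move=> _ _ /submxP[a ->] /submxP[b ->].
have skewQ : Q^T = - Q.
  by rewrite -JPQ !trmx_mul trmxK skewP mulNmx mulmxN mulmxA.
rewrite !fJ !push !leaf_formE // trmx_mul -push trmx_inv trmxK.
by rewrite -!mulmxA [J *m _]mulmxA mulmxV // mul1mx.
Qed.

End LinearSymplectic.

Section Tangent.
Variables (K : numFieldType) (Lam : zmodType) (n : nat) (s : seed Lam n).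
Implicit Types (x v : 'rV[K]_n).

Let HK : 'M[K]_n := map_mx ratr (seed_form_mx s).

Lemma seed_form_ratr_skew : HK^T = - HK.
Proof. by rewrite /HK map_trmx seed_form_mx_skew map_mxN. Qed.

Lemma seed_bivecE x : seed_bivec s x = diag_mx x *m HK *m diag_mx x.
Proof.
apply/matrixP => i j; rewrite mul_mx_diag mxE [RHS]mxE mul_diag_mx !mxE.
by rewrite [x 0 i * _]mulrC.
Qed.

Lemma seed_bivec_skew x : (seed_bivec s x)^T = - seed_bivec s x.
Proof.
rewrite seed_bivecE !trmx_mul seed_form_ratr_skew !tr_diag_mx.
by rewrite mulNmx mulmxN mulmxA.
Qed.

Lemma seed_form_ratr_kernel (c : 'rV[int]_n) (t : 'rV[K]_n) :
  int_kernel (seed_form_mx s) c ->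
  \sum_i (c 0 i)%:~R * (t *m HK) 0 i = 0.
Proof.
move=> ck; transitivity ((t *m HK *m (map_mx intr c)^T) 0 0).
  by rewrite [RHS]mxE; apply: eq_bigr => i _; rewrite !mxE mulrC.
rewrite -mulmxA -[HK]trmxK -trmx_mul seed_form_ratr_skew mulmxN.
have -> : map_mx intr c *m HK = 0.
  rewrite -[0 in RHS](map_mx0 (@ratr K)) -ck map_mxM; congr (_ *m _).
  by apply/rowP => i; rewrite !mxE rmorph_int.
by rewrite oppr0 trmx0 mulmx0 mxE.
Qed.

(** After division by x the differentials of the characters in the kernel are
    the integral kernel vectors, and the Hamiltonian vectors are the row space
    of the matrix of the form; they are annihilators of each other. *)
Lemma fiber_tangentP x v : torus x ->
  fiber_tangent s x v <-> (v <= seed_bivec s x)%MS.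
Proof.
move=> tx; pose w := v *m diag_mx (\row_i (x 0 i)^-1).
have wE i : w 0 i = v 0 i / x 0 i by rewrite /w mul_mx_diag !mxE.
have vE : v = w *m diag_mx x.
  by apply/rowP => i; rewrite mul_mx_diag mxE wE divfK ?tx.
have DE a : 'D_v (character s a) x =
    character s a x * \sum_i (coord s a 0 i)%:~R * w 0 i.
  rewrite (logdiff_derive v (logdiff_mono (coord s a) tx)); congr (_ * _).
  by apply: eq_bigr => i _; rewrite wE.
split=> [vt|/submxP[b vb] a /KerL_int_kernel ak].
  have [|t wt] := kernel_annihilator (u := w) (seed_form_mx_skew s).
    move=> c ck; have /vt/eqP : KerL s (lincomb s c).
      by rewrite KerL_int_kernel lincombK.
    by rewrite DE lincombK mulf_eq0 (negbTE (mono_neq0 _ tx)) => /eqP.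
  rewrite seed_bivecE vE wt.
  have -> : t = t *m diag_mx (\row_i (x 0 i)^-1) *m diag_mx x.
    by apply/rowP => i; rewrite !mul_mx_diag !mxE divfK ?tx.
  by rewrite -!mulmxA mulmxA submxMl.
rewrite DE; have -> : w = (b *m diag_mx x) *m HK.
  apply/rowP => i; rewrite wE vb seed_bivecE !mulmxA mul_mx_diag mxE.
  by rewrite mulfK ?tx.
by rewrite seed_form_ratr_kernel // mulr0.
Qed.

End Tangent.

Section MutationPoisson.
Variables (K : numFieldType) (Lam : zmodType) (n : nat) (s : seed Lam n).
Variables (k : 'I_n) (hk : k \notin frozen s).
Implicit Types (x v : 'rV[K]_n).

Let slope x i : K :=
  (mut_exp s k i)%:~R - (epsz s i k)%:~R * (x 0 k / (1 + x 0 k)).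

(** From x_i x_k^(m_i) (1 + x_k)^(- eps_ik); at i = k the slope is m_k = -2,
    which gives the differential - v_k / x_k of the inversion. *)
Lemma logdiff_mut x i : torus x -> mut_dom s k x ->
  logdiff (fun y : 'rV[K]_n => mut_map s k y 0 i) x
    (fun v => v 0 i / x 0 i + slope x i * (v 0 k / x 0 k)).
Proof.
move=> tx xd; have lk := logdiff_coord (tx k).
have [->|ik] := eqVneq i k.
  under eq_fun do rewrite mut_map_k.
  apply: logdiff_ext (logdiffV lk) => v.
  rewrite /slope /mut_exp eqxx epsz_self // mul0r subr0.
  by rewrite -[(- 2)%:~R]/(- 2 : K); ring.
rewrite (_ : (fun y => _) = fun y : 'rV[K]_n => y 0 i *
  (1 + y 0 k ^ (- sgz (epsz s i k))) ^ (- epsz s i k)); last first.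
  by apply/funext => y; rewrite mxE (negbTE ik).
apply: logdiff_ext (logdiffM (logdiff_coord (tx i))
  (logdiffXz _ (logdiff_add1 (logdiffXz _ lk) (xd i ik)))) => v.
congr (_ + _); rewrite !mulrA; congr (_ * _ / _); rewrite /slope /mut_exp.
rewrite (negbTE ik).
have x1 : epsz s i k != 0 -> 1 + x 0 k != 0.
  by have [//|->] := (mut_domP hk tx).1 xd; rewrite eqxx.
case: (ltgtP (epsz s i k) 0) => e; last by rewrite e oppr0 !mul0r subrr.
  rewrite ltr0_sgz // opprK expr1z mulr1 sub0r mulrNz.
  by ring.
rewrite gtr0_sgz // exprN1 !mulrNz.
have {}x1 := x1 (lt0r_neq0 e).
have x1' : x 0 k + 1 != 0 by rewrite addrC.
have xk := tx k.
by field; rewrite ?xk ?x1 ?x1'.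
Qed.

(** In logarithmic coordinates the differential is E = 1 + e_k q with q the
    row of slopes, an involution since q_k = -2. The map e_i -> e_i + m_i e_k
    of lattices is the same with m in place of q, and both transport the form
    in the same way since q - m is proportional to (eps_ik)_i, which is itself
    proportional to the column of e_k in the matrix of the skew form. *)
Lemma poisson_at_mut x : torus x -> mut_dom s k x ->
  poisson_at (mut_map s k) x (seed_bivec s x)
    (seed_bivec (mutate hk) (mut_map s k x)).
Proof.
move=> tx xd; set y := mut_map s k x.
have [|df dfE] := @differentiable_row _ _ _ (mut_map s k) x.
  by move=> i; have [] := logdiff_mut i tx xd.
split=> //.
pose q : 'rV[K]_n := \row_i slope x i.
pose d : 'cV[K]_n := delta_mx k 0.
pose E := 1%:M + d *m q.
have qd : q *m d = (- 2)%:M.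
  apply/matrixP => a b; rewrite !ord1 -colE !mxE eqxx.
  by rewrite /slope /mut_exp eqxx epsz_self // mul0r subr0.
have EE : E *m E = 1%:M.
  have PP : d *m q *m (d *m q) = - (d *m q) - d *m q.
    rewrite -mulmxA [q *m _]mulmxA qd mul_scalar_mx -scalemxAr scaleNr.
    by rewrite scaler_nat mulr2n opprD.
  rewrite /E mulmxDl mul1mx mulmxDr mulmx1 PP [_ + (- _ - _)]addrA subrr sub0r.
  by rewrite addrK.
pose xV : 'rV[K]_n := \row_i (x 0 i)^-1.
have unit_diag (z : 'rV[K]_n) : torus z -> diag_mx z \in unitmx.
  by move=> tz; rewrite unitmxE det_diag unitfE; apply/prodf_neq0.
have xVK : diag_mx xV *m diag_mx x = 1%:M.
  apply/matrixP => i j; rewrite mul_mx_diag !mxE.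
  by case: eqVneq => [->|]; rewrite ?mul0r ?mulr1n ?mulr0n // mulVf ?tx.
exists (diag_mx xV *m E *m diag_mx y).
  rewrite !unitmx_mul !unit_diag ?andbT //=; first by have [] := mulmx1_unit EE.
    exact: mut_map_torus.
  by move=> i; rewrite mxE invr_neq0 ?tx.
split=> [v|].
  apply/rowP => i; rewrite dfE; have [_ _ ->] := logdiff_mut i tx xd.
  rewrite mulmxA mul_mx_diag [RHS]mxE [LHS]mulrC; congr (_ * _).
  rewrite mulmxA /E mulmxDr mulmx1 mxE mul_mx_diag mulmxA -colE.
  by rewrite !mxE big_ord1 !mxE [_ * slope x i]mulrC.
rewrite !seed_bivecE !trmx_mul !tr_diag_mx.
rewrite -!mulmxA [diag_mx x *m (diag_mx xV *m _)]mulmxA (diag_mxC x) xVK mul1mx.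
rewrite [diag_mx xV *m (diag_mx x *m _)]mulmxA xVK mul1mx.
rewrite 2![_ *m (_ *m diag_mx y)]mulmxA.
rewrite [E^T *m _]mulmxA; congr (_ *m (_ *m _)).
apply/matrixP => i j.
set H := map_mx ratr (seed_form_mx s).
have HE a b : H a b = ratr (hateps s a b) by rewrite !mxE.
have -> : (E^T *m H *m E) i j =
    H i j + H i k * slope x j + slope x i * H k j.
  have Hkk : d^T *m H *m d = 0.
    apply/matrixP => a b; rewrite trmx_delta -rowE -colE !ord1 2!mxE HE.
    by rewrite /hateps form_id rmorph0 mxE.
  have -> : E^T *m H *m E = H + H *m d *m q + q^T *m (d^T *m H).
    have -> : E^T = 1%:M + q^T *m d^T by rewrite /E linearD /= trmx1 trmx_mul.
    have Hkk' : q^T *m d^T *m H *m d *m q = 0.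
      rewrite -!mulmxA [d^T *m _]mulmxA [d^T *m H *m _]mulmxA Hkk.
      by rewrite mul0mx mulmx0.
    rewrite /E mulmxDl mul1mx !mulmxDr !mulmx1 mulmxDl !mulmxA Hkk' addr0.
    by rewrite addrAC.
  rewrite trmx_delta -rowE -colE.
  rewrite [LHS]mxE [X in X + _ = _]mxE; congr (_ + _ + _).
    by rewrite mxE big_ord1 [q _ _]mxE [col _ _ _ _]mxE.
  by rewrite mxE big_ord1 [q^T _ _]mxE [q _ _]mxE [row _ _ _ _]mxE.
have -> : map_mx ratr (seed_form_mx (mutate hk)) i j =
    ratr (form s (mut_basis s k i) (mut_basis s k j)) :> K by rewrite !mxE.
rewrite !mut_basisE formDl !formDr !formMz !formMzr form_id !mulr0 addr0.
rewrite !rmorphD !rmorphM /= !rmorph_int -!/(hateps s _ _) !HE /slope.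
have epsK l : (epsz s l k)%:~R = ratr (hateps s l k) * (dmul s k)%:R :> K.
  by rewrite -(rmorph_int (@ratr K)) epsz_eps // /eps rmorphM /= rmorph_nat.
have skewK : ratr (hateps s k j) = - ratr (hateps s j k) :> K.
  by rewrite -rmorphN /= /hateps [in LHS]form_skew.
by rewrite !epsK skewK; ring.
Qed.

End MutationPoisson.

(** * Cluster transformations between fibers *)

Section IsoPoisson.
Variables (K : numFieldType) (Lam : zmodType) (n : nat) (t u : seed Lam n).
Variable f : seed_iso t u.

Lemma poisson_at_iso (x : 'rV[K]_n) :
  poisson_at (iso_map f) x (seed_bivec t x) (seed_bivec u (iso_map f x)).
Proof.
have E (j : 'I_n) : (fun y : 'rV[K]_n => iso_map f y 0 j) =
    (fun y => y 0 ((iso_perm f)^-1%g j)).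
  by apply/funext => y; rewrite mxE.
have [|df dfE] := @differentiable_row _ _ _ (@iso_map K _ _ _ _ f) x.
  by move=> j; rewrite E; exact: differentiable_coord.
split=> //; exists (perm_mx (iso_perm f)); first exact: unitmx_perm.
have mulP m (A : 'M[K]_(m, n)) :
    A *m perm_mx (iso_perm f) = col_perm (iso_perm f)^-1%g A.
  by rewrite col_permE invgK.
split=> [v|].
  by apply/rowP => j; rewrite dfE E diff_coord mulP mxE.
rewrite tr_perm_mx -row_permE mulP; apply/matrixP => i j; rewrite !mxE.
by rewrite -(iso_form f) !permKV.
Qed.

Definition iso_inv (y : 'rV[K]_n) : 'rV[K]_n := \row_i y 0 (iso_perm f i).

Lemma iso_mapK x : iso_inv (iso_map f x) = x.
Proof. by apply/rowP => i; rewrite !mxE permK. Qed.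

Lemma iso_invK x : iso_map f (iso_inv x) = x.
Proof. by apply/rowP => i; rewrite !mxE permKV. Qed.

Lemma iso_inv_continuous x : {for x, continuous iso_inv}.
Proof.
apply: differentiable_continuous; apply: (differentiable_row _).1 => i.
rewrite (_ : (fun y => _) = fun y : 'rV[K]_n => y 0 (iso_perm f i)).
  exact: differentiable_coord.
by apply/funext => y; rewrite mxE.
Qed.

End IsoPoisson.

Section PathPoisson.
Variables (K : numFieldType) (Lam : zmodType) (n : nat) (s : seed Lam n).

Lemma poisson_at_path t (c : cluster_path s t) (x : 'rV[K]_n) :
  path_dom K c x ->
  poisson_at (path_map K c) x (seed_bivec s x) (seed_bivec t (path_map K c x)).
Proof.
elim: c => /= [_|t' c IH k hk [xc xd]|t' u c IH f xc].
- exact: poisson_at_id.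
- apply: poisson_at_comp (IH xc) _; apply: poisson_at_mut => //.
  by have [] := path_character xc.
- apply: poisson_at_comp (IH xc) _; exact: poisson_at_iso.
Qed.

Lemma fiber_symplectic_path t (c : cluster_path s t) (h : Lam -> K) :
  fiber_symplectic c h.
Proof.
move=> x _ xc y; have [tx ty _] := path_character xc.
have [df dim dform] :=
  poisson_at_leaf (seed_bivec_skew s x) (poisson_at_path xc).
have tanE : fiber_tangent s x = [set v | (v <= seed_bivec s x)%MS].
  by apply/seteqP; split=> v /fiber_tangentP; exact.
have tanE' : fiber_tangent t y = [set v | (v <= seed_bivec t y)%MS].
  by apply/seteqP; split=> v /fiber_tangentP; exact.
split=> //; first by rewrite tanE tanE' dim.
by move=> v w; rewrite tanE => vt wt; exact: dform.
Qed.

End PathPoisson.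

Lemma nbhs_neq0 (K : numFieldType) (V : topologicalType) (f : V -> K) (p : V) :
  {for p, continuous f} -> f p != 0 -> \forall y \near p, f y != 0.
Proof.
move=> fc fp; have : nbhs (f p) [set z : K | z != 0].
  apply/nbhs_ballP; exists `|f p|; first by rewrite /= normr_gt0.
  move=> z /=; rewrite -ball_normE /= => zlt.
  by apply/eqP => z0; rewrite z0 subr0 ltxx in zlt.
by move=> /fc.
Qed.

Section Openness.
Variables (K : numFieldType) (n : nat).

Lemma torus_nbhs (x : 'rV[K]_n) : torus x -> nbhs x (@torus K n).
Proof.
move=> tx; have [p0 dp _] := logdiff_prod (index_enum 'I_n)
  (fun i => logdiff_coord (tx i)).
have := nbhs_neq0 (differentiable_continuous dp) p0.
by apply: filterS => y /= /prodf_neq0 y0 i; exact: y0.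
Qed.

Lemma torus_open : open (@torus K n).
Proof. by rewrite openE => x /torus_nbhs. Qed.

Variables (Lam : zmodType).

Lemma mut_inv_continuous (s : seed Lam n) k (hk : k \notin frozen s)
  (y : 'rV[K]_n) : torus y -> mut_inv_dom s k y ->
  {for y, continuous (@mut_inv _ _ s k K)}.
Proof.
move=> ty yd; apply: differentiable_continuous.
apply: (differentiable_row _).1 => i.
rewrite (_ : (fun z => _) = fun z : 'rV[K]_n =>
  z 0 i * (z 0 k)^-1 ^ (- mut_exp s k i) *
  (1 + (z 0 k)^-1) ^ epsz s i k); last first.
  by apply/funext => z; rewrite mxE.
have lV := logdiffV (logdiff_coord (ty k)).
have l1 := logdiffM (logdiff_coord (ty i)) (logdiffXz (- mut_exp s k i) lV).
case: yd => [y1|->]; last first.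
  by have [_ d1 _] := l1; under eq_fun do rewrite expr0z mulr1.
by have [_ d1 _] := logdiffM l1 (logdiffXz (epsz s i k) (logdiff_add1 lV y1)).
Qed.

Lemma mut_inv_dom_nbhs (s : seed Lam n) k (y : 'rV[K]_n) :
  torus y -> mut_inv_dom s k y -> nbhs y (mut_inv_dom (K := K) s k).
Proof.
move=> ty [y1|e0]; last by apply: filterE => z; right.
have [_ d1 _] := logdiff_add1 (logdiffV (logdiff_coord (ty k))) y1.
have := nbhs_neq0 (differentiable_continuous d1) y1.
by apply: filterS => z; left.
Qed.

(** Cluster transformations are open on their domain, since every mutation has
    a continuous local inverse; hence it suffices to perturb points in the
    target. *)
Lemma path_open (s t : seed Lam n) (c : cluster_path s t) (x : 'rV[K]_n) B :
  path_dom K c x -> nbhs x B ->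
  nbhs (path_map K c x)
    [set y | exists x1, [/\ B x1, path_dom K c x1 & path_map K c x1 = y]].
Proof.
elim: c => /= [tx xB|t' c IH k hk [xc xd] xB|t' u c IH f xc xB].
- have := torus_nbhs tx; apply: filterS2 xB => y yB ty.
  by exists y.
- have [_ ty _] := path_character xc.
  set y := path_map K c x in ty xd *.
  set z := mut_map t' k y.
  have tz : torus z by exact: mut_map_torus.
  have zy : mut_inv t' k z = y by exact: mut_mapK.
  have zd : mut_inv_dom t' k z.
    rewrite /mut_inv_dom mut_map_k invrK; exact: (mut_domP hk ty).1.
  have := IH xc xB; rewrite -/y -zy => /(mut_inv_continuous hk tz zd) yB.
  move: (torus_nbhs tz) (mut_inv_dom_nbhs tz zd) yB.
  apply: filterS3 => w tw wd [x1 [Bx1 x1c x1w]]; exists x1.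
  have [tw' wd'] := mut_inv_torus hk tw wd.
  split=> //; last by rewrite /= x1w mut_invK.
  by split=> //; rewrite x1w.
- set z := iso_map f (path_map K c x).
  have := IH xc xB; rewrite -(iso_mapK f (path_map K c x)) -/z => yB.
  have zB : nbhs z [set w | exists x1,
      [/\ B x1, path_dom K c x1 & path_map K c x1 = iso_inv f w]].
    exact: iso_inv_continuous yB.
  apply: filterS zB => w [x1 [Bx1 x1c x1w]].
  by exists x1; split=> //=; rewrite x1w iso_invK.
Qed.

Lemma path_inj (s t : seed Lam n) (c : cluster_path s t) :
  set_inj (path_dom K c) (path_map K c).
Proof.
elim: c => /= [x y _ _ //|t' c IH k hk x y|t' u c IH f x y].
  rewrite !inE => -[xc xd] [yc yd] /= xy.
  have [_ tx _] := path_character xc; have [_ ty _] := path_character yc.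
  apply: IH; rewrite ?inE //.
  by rewrite -(mut_mapK hk tx xd) xy mut_mapK.
rewrite !inE => xc yc /= xy; apply: IH; rewrite ?inE //.
by rewrite -(iso_mapK f (path_map K c x)) xy iso_mapK.
Qed.

End Openness.

Lemma epsz_mutate (Lam : zmodType) n (s : seed Lam n) k
    (hk : k \notin frozen s) i :
  epsz (mutate hk) i k = - epsz s i k.
Proof.
apply: (@intr_inj rat).
rewrite rmorphN /= (@epsz_eps _ _ (mutate hk)) // epsz_eps //.
rewrite /eps /hateps /= !mut_basisE formDl !formDr !formMz !formMzr form_id.
rewrite /mut_exp eqxx !mulr0 !addr0 -[(- 2)%:~R]/(- 2 : rat); ring.
Qed.

Section Density.
Variables (K : numFieldType) (ex : K -> K).
Hypotheses (ex0 : ex 0 = 1) (exD : forall u v, ex (u + v) = ex u * ex v).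
Hypothesis dex : forall u : K, is_derive u 1 ex (ex u).
Variables (Lam : zmodType) (n : nat).
Implicit Types (s t : seed Lam n) (x y : 'rV[K]_n).

(** The Hamiltonian flow of the multivalued function log X_j. *)
Definition flow s (j : 'I_n) x (u : K) : 'rV[K]_n :=
  \row_i (x 0 i * ex (u * ratr (hateps s j i))).

Lemma flow0 s j x : flow s j x 0 = x.
Proof. by apply/rowP => i; rewrite mxE mul0r ex0 mulr1. Qed.

Lemma flow_fiber s j x u h :
  theta_fiber s h x -> theta_fiber s h (flow s j x u).
Proof.
move=> [tx xh]; split=> [i|a ak].
  by rewrite mxE mulf_neq0 ?hom_exp_neq0 ?tx.
rewrite -xh //; pose e : 'rV[K]_n := \row_i ex (u * ratr (hateps s j i)).
have -> : character s a (flow s j x u) =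
    mono x (coord s a) * mono e (coord s a).
  by apply: monoMl => i; rewrite !mxE.
rewrite (_ : mono e _ = 1) ?mulr1 //.
pose d : 'rV[K]_n := u *: delta_mx 0 j.
have dE i : (d *m map_mx ratr (seed_form_mx s)) 0 i = u * ratr (hateps s j i).
  by rewrite -scalemxAl mxE -rowE !mxE.
have := seed_form_ratr_kernel d ((KerL_int_kernel s a).1 ak) => /(congr1 ex).
rewrite ex0 (hom_exp_sum ex0 exD) => <-; apply: eq_bigr => i _.
by rewrite (hom_expMz ex0 exD) dE [e _ _]mxE.
Qed.

Lemma exp_scale_derive (a u : K) :
  is_derive u 1 (fun w => ex (w * a)) (ex (u * a) * a).
Proof.
have [dm mE] : is_diff u (fun w : K => w * a) (fun w : K => w * a).
  exact: (is_diff_scalel u (a : K)).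
have [/derivable1_diffP de exE] := dex (u * a).
have dc : differentiable (ex \o (fun w : K => w * a)) u.
  exact: differentiable_comp.
apply: DeriveDef; first exact/derivable1_diffP.
rewrite deriveE //.
transitivity ('d ex (u * a) ('d (fun w : K => w * a) u 1)).
  by have /(congr1 (@^~ 1)) := diff_comp dm de.
have m1 : 'd (fun w : K => w * a) u 1 = a.
  by apply: etrans (congr1 (@^~ 1) mE) _; rewrite mul1r.
apply: etrans (congr1 ('d ex (u * a)) m1) _.
apply: etrans (congr1 (@^~ a) (diff1E de)) _.
by rewrite derive1E exE [_ *: _]mulrC.
Qed.

Lemma flow_continuous s j x : {for 0, continuous (flow s j x)}.
Proof.
apply: differentiable_continuous; apply: (differentiable_row _).1 => i.
rewrite (_ : (fun z => _) =
  (fun u => x 0 i *: ex (u * ratr (hateps s j i)))); last first.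
  by apply/funext => u; rewrite mxE.
apply: differentiableZ; apply/derivable1_diffP.
by have [] := exp_scale_derive (ratr (hateps s j i)) 0.
Qed.

(** Otherwise exp would be locally constant at 0, against exp' (0) = 1. *)
Lemma exp_nontrivial (a : K) (B : set K) : a != 0 -> nbhs 0 B ->
  exists2 u, B u & ex (u * a) != 1.
Proof.
move=> a0 B0; apply: contrapT => nB.
have ex1 : \forall u \near (0 : K), ex (u * a) = cst 1 u.
  apply: filterS B0 => u Bu; apply: contrapT => /eqP u1; apply: nB.
  by exists u.
have [_ d1] := near_eq_is_derive ex1 (exp_scale_derive a 0).
have := derive_cst (1 : K) (0 : K) (1 : K).
by rewrite d1 mul0r ex0 mul1r => /eqP; rewrite (negbTE a0).
Qed.

(** If x_k = -1 and some eps_jk is nonzero, then x_k is not constant along the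
    flow of log X_j, which stays in the fiber. *)
Lemma fiber_perturb s h k y B : k \notin frozen s ->
  theta_fiber s h y -> nbhs y B ->
  exists y1, [/\ theta_fiber s h y1, B y1 &
    1 + y1 0 k != 0 \/ forall i, epsz s i k = 0].
Proof.
move=> hk yh yB; have [y1|y1] := boolP (1 + y 0 k != 0).
  by exists y; split=> //; [exact: nbhs_singleton|left].
have [e0|] := pselect (forall i, epsz s i k = 0).
  by exists y; split=> //; [exact: nbhs_singleton|right].
move=> /existsNP[j /eqP]; rewrite epsz_eq0 // => ejk.
have a0 : ratr (hateps s j k) != 0 :> K by rewrite fmorph_eq0.
have fB : nbhs 0 [set u | B (flow s j y u)].
  by apply: flow_continuous; rewrite flow0.
have [u Bu u1] := exp_nontrivial a0 fB.
exists (flow s j y u); split=> //; first exact: flow_fiber.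
left; rewrite mxE; move: y1; rewrite negbK addrC addr_eq0 => /eqP ->.
by rewrite mulN1r subr_eq0 eq_sym.
Qed.

(** The last mutation of the path is dealt with in its source: a point of the
    fiber there is perturbed, and openness brings the perturbation back. *)
Lemma path_dom_dense s t (c : cluster_path s t) h :
  theta_fiber s h `<=` closure (theta_fiber s h `&` path_dom K c).
Proof.
elim: c => /= [|t' c IH k hk|t' u c IH f //].
  by move=> x [tx xh] B /nbhs_singleton Bx; exists x.
move=> x xh B; rewrite nbhsE => -[B' [oB' B'x] B'B].
have [x0 [[[tx0 x0h] x0c] B'x0]] := IH x xh B' (open_nbhs_nbhs (conj oB' B'x)).
have [_ ty x0ch] := path_character x0c.
have yfib : theta_fiber t' (fun a => character t' a (path_map K c x0))
  (path_map K c x0) by [].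
have [y1 [[ty1 y1h] [x1 [B'x1 x1c x1y]] y1k]] := fiber_perturb hk yfib
  (path_open x0c (open_nbhs_nbhs (conj oB' B'x0))).
have [tx1 _ x1ch] := path_character x1c.
exists x1; split; last exact: B'B.
split; last by split=> //; apply/(mut_domP hk); rewrite x1y.
split=> // a ak; rewrite -x1ch // x1y y1h; last exact/path_KerL.
by rewrite x0ch // x0h.
Qed.

(** Here the perturbation takes place in the target of the last mutation, whose
    inverse is undefined where 1 + 1 / z_k vanishes. *)
Lemma path_image_dense s t (c : cluster_path s t) h y :
  torus y -> (forall a, KerL s a -> character t (path_lattice c a) y = h a) ->
  closure (path_map K c @` (theta_fiber s h `&` path_dom K c)) y.
Proof.
elim: c y => /= [y ty yh B /nbhs_singleton By|t' c IH k hk z tz zh B zB|].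
- by exists y; split=> //; exists y.
- have zfib :
    theta_fiber (mutate hk) (fun a => character (mutate hk) a z) z by [].
  move: zB; rewrite nbhsE => -[B' [oB' B'z] B'B].
  have [z1 [[tz1 z1h] B'z1 z1k]] :=
    fiber_perturb (s := mutate hk) hk zfib (open_nbhs_nbhs (conj oB' B'z)).
  have z1d : mut_inv_dom t' k z1.
    rewrite /mut_inv_dom; case: z1k => [z1k|e0]; [left|right].
      have -> : 1 + (z1 0 k)^-1 = (1 + z1 0 k) / z1 0 k.
        by rewrite mulrDl mul1r mulfV ?tz1 // addrC.
      by rewrite mulf_neq0 ?invr_neq0 ?tz1.
    by move=> i; apply/eqP; rewrite -oppr_eq0 -(epsz_mutate hk) e0.
  have [ty yd] := mut_inv_torus hk tz1 z1d.
  have yz1 := mut_invK hk tz1 z1d.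
  set y := mut_inv t' k z1 in ty yd yz1.
  have yB' : nbhs y (mut_map t' k @^-1` B').
    have := differentiable_continuous (poisson_at_mut hk ty yd).1.
    by apply; rewrite yz1; exact: open_nbhs_nbhs.
  have yD : nbhs y (@mut_dom _ _ t' k K).
    have := torus_nbhs ty; have := (mut_domP hk ty).1 yd.
    case=> [y1|e0]; last first.
      by apply: filterS => w tw; apply/(mut_domP hk tw); right.
    have [_ d1 _] := logdiff_add1 (logdiff_coord (ty k)) y1.
    apply: filterS2 (nbhs_neq0 (differentiable_continuous d1) y1) => w tw w1.
    by apply/(mut_domP hk w1); left.
  have yh a : KerL s a -> character t' (path_lattice c a) y = h a.
    move=> ak; rewrite -zh // -z1h; last by apply/KerL_mutate/path_KerL.
    by rewrite -yz1 character_mut //; apply/path_KerL.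
  have [_ [[x [xh xc] <-] [B'x Dx]]] := IH y ty yh _ (filterI yB' yD).
  by exists (mut_map t' k (path_map K c x)); split; [exists x | exact: B'B].
- move=> t' u c IH f z tz zh B zB.
  have tv : torus (iso_inv f z) by move=> i; rewrite mxE.
  have vh a : KerL s a -> character t' (path_lattice c a) (iso_inv f z) = h a.
    by move=> /zh <-; rewrite -[X in character u X]/(iso_lattice f _)
      -[in RHS](iso_invK f z) character_iso.
  have vB : nbhs (iso_inv f z) (iso_map f @^-1` B).
    have := differentiable_continuous (poisson_at_iso f (iso_inv f z)).1.
    by apply; rewrite iso_invK.
  have [_ [[x [xh xc] <-] Bx]] := IH _ tv vh _ vB.
  by exists (iso_map f (path_map K c x)); split=> //; exists x.
Qed.

Lemma fiber_birational_path s t (c : cluster_path s t) (h h' : Lam -> K) :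
  (forall a, KerL s a -> h' (path_lattice c a) = h a) ->
  fiber_birational c h h'.
Proof.
move=> hh'; split.
- move=> _ [x [[_ xh] xc] <-]; have [_ ty xch] := path_character xc.
  split=> // b bk; have [a ab] := path_lattice_surj c b.
  by move: bk; rewrite -ab path_KerL => ak; rewrite xch // xh // hh'.
- move=> x y; rewrite !inE => -[_ xc] [_ yc].
  by apply: (path_inj (c := c)); rewrite inE.
- exact: path_dom_dense.
- move=> y [ty yh]; apply: path_image_dense => // a ak.
  by rewrite yh ?hh' //; apply/path_KerL.
Qed.

End Density.

(** * Hamiltonian curves *)

Section Curves.
Variables (K : numFieldType) (n : nat).

Lemma is_derive_row (g : K -> 'rV[K]_n) (t : K) (w : 'rV[K]_n) :
  (forall i, is_derive t 1 (fun u => g u 0 i) (w 0 i)) -> is_derive t 1 g w.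
Proof.
move=> gi; have [|dg dgE] := @differentiable_row _ _ _ g t.
  by move=> i; apply/derivable1_diffP; have [] := gi i.
apply: DeriveDef; first exact/derivable1_diffP.
rewrite deriveE //; apply/rowP => i; rewrite dgE.
by have [/derivable1_diffP di <-] := gi i; rewrite deriveE.
Qed.

Lemma smooth_cst (U : set 'rV[K]_n) (a : K) : smooth_on U (fun=> a).
Proof.
move=> m; elim: m a => [a x _|m IH a]; first exact: cst_continuous.
split=> [i x _|i]; first exact: derivable_cst.
rewrite (_ : partial i _ = fun=> 0) //; apply/funext => x.
exact: derive_cst.
Qed.

Lemma partial_coord i j (x : 'rV[K]_n) :
  partial i (fun y : 'rV[K]_n => y 0 j) x = (i == j)%:R.
Proof.
rewrite /partial deriveE; last exact: differentiable_coord.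
by rewrite diff_coord mxE eqxx eq_sym.
Qed.

Lemma smooth_coord (U : set 'rV[K]_n) j : smooth_on U (fun y => y 0 j).
Proof.
case=> [x _|m]; first exact: coord_continuous.
split=> [i x _|i]; first exact/diff_derivable/differentiable_coord.
rewrite (_ : partial i _ = fun=> (i == j)%:R); first exact: smooth_cst.
by apply/funext => x; rewrite partial_coord.
Qed.

Variables (Lam : zmodType) (s : seed Lam n).

Lemma ham_field_coord j (y : 'rV[K]_n) i :
  ham_field (seed_bivec s) (fun z => z 0 j) y 0 i =
  ratr (hateps s j i) * y 0 j * y 0 i.
Proof.
rewrite /ham_field (_ : grad _ _ = delta_mx 0 j) -?rowE ?mxE //.
by apply/rowP => l; rewrite !mxE partial_coord eq_sym.
Qed.

(** The Hamiltonian field of any f is a D_y H D_y with a the gradient, and a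
    kernel vector of H kills its logarithmic version a D_y H. *)
Lemma character_ham_derive f (g : K -> 'rV[K]_n) t b : torus (g t) ->
  is_derive t 1 g (ham_field (seed_bivec s) f (g t)) -> KerL s b ->
  is_derive t 1 (fun u => character s b (g u)) 0.
Proof.
move=> tg [/derivable1_diffP dg gE] /KerL_int_kernel bk.
have [c0 dc cE] := logdiff_mono (coord s b) tg.
have dcg : differentiable (character s b \o g) t by exact: differentiable_comp.
apply: DeriveDef; first exact/derivable1_diffP.
rewrite deriveE //.
apply: etrans (congr1 (@^~ 1) (diff_comp dg dc)) _.
apply: etrans (cE _) _.
rewrite -(deriveE _ dg) gE /ham_field seed_bivecE !mulmxA.
rewrite [X in _ * X](_ : _ = 0) ?mulr0 //.
rewrite -[RHS](seed_form_ratr_kernel (grad f (g t) *m diag_mx (g t)) bk).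
by apply: eq_bigr => i _; rewrite mul_mx_diag mxE mulfK ?tg.
Qed.

End Curves.

Section Leaves.
Variables (K : numFieldType) (ex : K -> K).
Hypotheses (ex0 : ex 0 = 1) (exD : forall u v, ex (u + v) = ex u * ex v).
Hypothesis dex : forall u : K, is_derive u 1 ex (ex u).
Hypothesis derive0_const : forall (phi : K -> K) (a r : K),
  (forall t, ball a r t -> is_derive t 1 phi 0) ->
  forall t0 t1, ball a r t0 -> ball a r t1 -> phi t0 = phi t1.
Variables (Lam : zmodType) (n : nat) (s : seed Lam n).

Lemma ham_segment_invariant (P : poisson_space K n) (c : chart P) t
    (U : set 'rV[K]_n) f (a r : K) g t0 t1 b :
  bivec c = seed_bivec (t : seed Lam n) -> U `<=` @torus K n ->
  (forall u, ball a r u ->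
     U (g u) /\ is_derive u 1 g (ham_field (bivec c) f (g u))) ->
  ball a r t0 -> ball a r t1 -> KerL t b ->
  character t b (g t0) = character t b (g t1).
Proof.
move=> cE Ut gU b0 b1 bk.
apply: (derive0_const (phi := fun u => character t b (g u))) b0 b1 => u ub.
have [/Ut tg dg] := gU u ub; rewrite cE in dg.
exact: character_ham_derive dg bk.
Qed.

(** P is any space with a chart c in which the bivector is that of the seed; U
    is a region of that chart, invariant under the flows, in which ratios of
    monomials have logarithms. It is instantiated by the torus itself and by
    the initial chart of the manifold of positive points. *)
Section Chain.
Variables (P : poisson_space K n) (c : chart P) (U : set 'rV[K]_n).
Hypotheses (cE : bivec c = seed_bivec s) (oU : open U) (Ut : U `<=` @torus K n).
Hypotheses (Uc : forall x, U x -> exists p, at_coord c p x)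
  (c_inj : forall x p q, at_coord c p x -> at_coord c q x -> p = q).
Hypothesis Uflow : forall j x u, U x -> U (flow ex s j x u).

(** The Hamiltonian is the coordinate x_j rather than its logarithm, which is
    not globally defined; since x_j is constant along the curve, this only
    rescales time by x_j. *)
Lemma ham_segment_flow j x u p q : U x ->
  at_coord c p x -> at_coord c q (flow ex s j x u) -> ham_segment p q.
Proof.
move=> Ux px qx; have xj := Ut Ux j.
exists c, U, (fun y => y 0 j), 0, (`|u / x 0 j| + 1),
  (fun t => flow ex s j x (t * x 0 j)).
split=> //; first exact: smooth_coord.
  move=> t _; split; first exact: Uflow.
  apply: is_derive_row => i; rewrite cE ham_field_coord.
  rewrite (_ : (fun w => _) =
    (fun w => x 0 i *: ex (w * (x 0 j * ratr (hateps s j i))))); last first.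
    by apply/funext => w; rewrite mxE mulrA.
  have [de eE] := exp_scale_derive dex (x 0 j * ratr (hateps s j i)) t.
  apply: DeriveDef; first exact: derivableZ.
  rewrite (deriveZ _ de) eE !mxE /hateps form_id rmorph0 mulr0 ex0 mulr1.
  by rewrite -[t * _ * _]mulrA -[_ *: _]/(_ * _); ring.
exists 0, (u / x 0 j).
split; rewrite ?mul0r ?flow0 ?divfK //; rewrite -ball_normE /= sub0r.
  by rewrite oppr0 normr0 ltr_wpDl.
by rewrite normrN ltrDl.
Qed.

(** The flows commute, and their times add up in the exponent. *)
Lemma flow_chain (r : seq 'I_n) (u : 'rV[K]_n) x p q : U x ->
  at_coord c p x ->
  at_coord c q (\row_i
    (x 0 i * ex (\sum_(j <- r) u 0 j * ratr (hateps s j i)))) ->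
  clos_refl_trans _ (@ham_segment K n P) p q.
Proof.
elim: r x p => [|j r IH] x p Ux px qx.
  have -> : p = q; last exact: rt_refl.
  apply: c_inj px _; move: qx; congr (at_coord c q _).
  by apply/rowP => i; rewrite mxE big_nil ex0 mulr1.
have Ux1 := Uflow j (u 0 j) Ux; have [p1 px1] := Uc Ux1.
apply: rt_trans (rt_step _ _ _ _ (ham_segment_flow Ux px px1)) _.
apply: IH Ux1 px1 _; move: qx; congr (at_coord c q _).
by apply/rowP => i; rewrite !mxE big_cons exD mulrA.
Qed.

Hypothesis Ulog : forall x y d, U x -> U y ->
  exists u, ex u = mono (\row_i (y 0 i / x 0 i)) d.

Lemma fiber_chain x y p q : U x -> U y ->
  (forall a, KerL s a -> character s a x = character s a y) ->
  at_coord c p x -> at_coord c q y ->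
  clos_refl_trans _ (@ham_segment K n P) p q.
Proof.
move=> Ux Uy xy px qy.
pose z : 'rV[K]_n := \row_i (y 0 i / x 0 i).
have zx i : y 0 i = x 0 i * z 0 i by rewrite mxE mulrC divfK // Ut.
have z0 i : z 0 i != 0 by rewrite mxE mulf_neq0 ?invr_neq0 ?(Ut Uy) ?(Ut Ux).
have [//||t tE] := kernel_exp_image ex0 exD (seed_form_mx_skew s) z0.
- by move=> d; exact: Ulog.
- move=> d dk; have := xy (lincomb s d).
  rewrite KerL_int_kernel /character lincombK => /(_ dk) xyd.
  have xd0 := mono_neq0 d (Ut Ux); apply: (mulfI xd0); rewrite mulr1.
  by rewrite -(monoMl _ zx) /mono -xyd.
apply: (flow_chain (r := index_enum 'I_n) (u := t)) Ux px _.
move: qy; congr (at_coord c q _); apply/rowP => i.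
rewrite zx tE [RHS]mxE; congr (_ * ex _); rewrite mxE.
by apply: eq_bigr => j _; rewrite !mxE.
Qed.

End Chain.

Hypothesis ex_surj : forall z, z != 0 -> exists u, ex u = z.

Lemma torus_leafE x : torus x ->
  [set y | clos_refl_trans _ (@ham_segment K n (torus_space K s)) x y] =
  theta_fiber s (fun a => character s a x).
Proof.
move=> tx; apply/seteqP; split=> [y xy|y [ty yx]] /=.
  have step p q : ham_segment (P := torus_space K s) p q -> torus p ->
      torus q /\ forall b, KerL s b -> character s b q = character s b p.
    move=> [c [U [f [a [r [g [oU Ut _ gU]]]]]]].
    move=> [t0 [t1 [b0 b1 [-> tp] [-> tq]]]] _; split=> // b bk; symmetry.
    apply: (ham_segment_invariant (c := c)) gU b0 b1 bk => //.
    by move=> v /Ut [v' []].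
  elim: xy tx => {x y} [p q /step //|p //|p q w _ pq _ qw tp].
  have [/qw[tw wq] qp] := pq tp; split=> // b bk.
  by rewrite wq ?qp.
apply: (@fiber_chain (torus_space K s) tt (@torus K n) _ _ _ _ _ _ _ x y) => //.
- exact: torus_open.
- by move=> v tv; exists v.
- by move=> v p q [-> _] [-> _].
- move=> j v u tv.
  have vh : theta_fiber s (fun a => character s a v) v by [].
  by have [] := flow_fiber ex0 exD j u vh.
- move=> v w d tv tw; apply: ex_surj; apply: mono_neq0 => i.
  by rewrite mxE mulf_neq0 ?invr_neq0 ?tv ?tw.
- by move=> a ak; rewrite yx.
Qed.

Lemma torus_leafP (L : set 'rV[K]_n) :
  symplectic_leaf (torus_space K s) L <->
  exists2 h : Lam -> K, H_point s h & L = theta_fiber s h.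
Proof.
split=> [[p [[c [x [<- tp]]] ->]]|[h hh ->]].
  exists (fun a => character s a p); last exact: torus_leafE.
  split=> [a _|a b _ _]; first exact: mono_neq0.
  by rewrite /character coordD; exact: monoD.
have [x [[tx xh] _]] := theta_fiber_nonempty hh.
exists x; split; first by exists tt, x.
rewrite torus_leafE //; apply/seteqP; split=> y [ty yh]; split=> // a ak.
  by rewrite xh ?yh.
by rewrite -xh ?yh.
Qed.

End Leaves.

(** * The complex exponential and constancy of primitives of zero *)

(** An increment form of the derivative; it is what passes between the complex
    and the real topology, where no chain rule is available. *)
Lemma is_derive_epsP (K : numFieldType) (f : K -> K) (x d : K) :
  is_derive x 1 f d <->
  forall e, 0 < e -> \forall h \near (0 : K),
    `|f (h + x) - f x - d * h| <= e * `|h|.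
Proof.
have quot h : h != 0 ->
    `|d - h^-1 *: (f (h *: 1 + x) - f x)| * `|h| = `|f (h + x) - f x - d * h|.
  move=> h0; rewrite -normrM distrC mulrBl -[_ *: (_ - _)]/(_ * _).
  by rewrite [_^-1 * _ * _]mulrAC mulVf // mul1r -[h *: 1]/(h * 1) mulr1.
split=> [[df fE] e e0|fe].
  have := df; rewrite /derivable => /cvgrPdist_le /(_ e e0).
  rewrite -[lim _]/('D_1 f x) fE => hE.
  have {hE} : \forall h \near (0 : K), h != 0 ->
    `|d - h^-1 *: (f (h *: 1 + x) - f x)| <= e by exact: hE.
  apply: filterS => h hE; have [->|h0] := eqVneq h 0.
    by rewrite add0r subrr mulr0 subr0 normr0 mulr0.
  by rewrite -quot // ler_pM2r ?normr_gt0 //; exact: hE.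
have fd : (fun h => h^-1 *: (f (h *: 1 + x) - f x)) @ 0^' --> d.
  apply/cvgrPdist_le => e e0.
  suff : \forall h \near (0 : K), h != 0 ->
    `|d - h^-1 *: (f (h *: 1 + x) - f x)| <= e by [].
  have := fe e e0; apply: filterS => h hE h0.
  by rewrite -(ler_pM2r (_ : 0 < `|h|)) ?normr_gt0 // quot.
apply: DeriveDef; first by apply/cvg_ex; exists d.
exact: cvg_lim.
Qed.

Lemma ball_convex (K : numFieldType) (a r x y u : K) :
  ball a r x -> ball a r y -> 0 <= u -> u <= 1 -> ball a r (x + u * (y - x)).
Proof.
rewrite -ball_normE /= => bx b_y u0 u1.
have -> : a - (x + u * (y - x)) = (1 - u) * (a - x) + u * (a - y) by ring.
apply: le_lt_trans (ler_normD _ _) _; rewrite !normrM.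
have u1' : 0 <= 1 - u by rewrite subr_ge0.
rewrite (ger0_norm u0) (ger0_norm u1') -subr_gt0.
have -> : r - ((1 - u) * `|a - x| + u * `|a - y|) =
    (1 - u) * (r - `|a - x|) + u * (r - `|a - y|) by ring.
have [->|un0] := eqVneq u 0; first by rewrite subr0 mul1r mul0r addr0 subr_gt0.
have uC0 : 0 < u by rewrite lt_def un0.
by rewrite ltr_wpDl ?mulr_ge0 ?mulr_gt0 ?subr_gt0 // subr_ge0 ltW.
Qed.

Section RealConst.
Variable R : realType.

Lemma derive0_segment (psi : R -> R) (x y : R) : x <= y ->
  (forall t : R, x <= t <= y -> is_derive t 1 psi 0) -> psi x = psi y.
Proof.
move=> xy dpsi; apply/eqP; rewrite eq_sym -subr_eq0.
have [||c _ ->] := @MVT_segment _ psi (fun=> 0) x y xy.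
- move=> t; rewrite in_itv /= => /andP[/ltW t0 /ltW t1].
  by apply: dpsi; rewrite t0.
- apply: derivable_within_continuous => t; rewrite in_itv /= => t01.
  by have [] := dpsi t t01.
- by rewrite mul0r.
Qed.

Lemma derive0_const_real (phi : R -> R) (a r : R) :
  (forall t : R, ball a r t -> is_derive t 1 phi 0) ->
  forall t0 t1 : R, ball a r t0 -> ball a r t1 -> phi t0 = phi t1.
Proof.
move=> dphi t0 t1; wlog t01 : t0 t1 / t0 <= t1.
  move=> H b0 b1; have [t01|/ltW t10] := leP t0 t1; first exact: H.
  by rewrite (H t1 t0).
rewrite -ball_normE /= !ltr_distlC => /andP[b0 _] /andP[_ b1].
apply: derive0_segment t01 _ => t /andP[t0t tt1]; apply: dphi.
rewrite -ball_normE /= ltr_distlC (lt_le_trans b0) //=.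
exact: le_lt_trans b1.
Qed.

End RealConst.

Section Complex.
Variable R : realType.
Local Notation C := R[i].
Let K : numFieldType := C.
Implicit Types z w : C.

Lemma norm_re_le z : `|complex.Re z|%:C%C <= `|z|.
Proof. exact: normc_ge_Re. Qed.

Lemma norm_im_le z : `|complex.Im z|%:C%C <= `|z|.
Proof.
rewrite normc_def lecR -sqrtr_sqr ler_wsqrtr // lerDr; exact: sqr_ge0.
Qed.

Lemma norm_le_reim z : `|z| <= (`|complex.Re z| + `|complex.Im z|)%:C%C.
Proof.
rewrite normc_def lecR -[leRHS]ger0_norm ?addr_ge0 // -sqrtr_sqr ler_wsqrtr //.
rewrite sqrrD !real_normK ?num_real // -addrA [X in _ <= _ + X]addrC addrA.
by rewrite lerDl mulrn_wge0 // mulr_ge0.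
Qed.

Lemma near0_complexP (P : C -> Prop) :
  (\forall h \near (0 : K), P h) <->
  exists2 d : R, 0 < d & forall h, `|h| < d%:C%C -> P h.
Proof.
split=> [/nbhs_ballP[d /= d0 dP]|[d d0 dP]].
  move: d0; rewrite ltcE /= => /andP[/eqP d1 d0].
  exists (complex.Re d) => // h hd; apply: dP.
  rewrite -ball_normE /= sub0r normrN; move: hd; congr (_ < _).
  by case: d d1 {d0} => x y /= ->.
apply/nbhs_ballP; exists d%:C%C; first by rewrite /= ltcR.
by move=> h; rewrite -ball_normE /= sub0r normrN => /dP.
Qed.

Lemma normC_real z : `|z| = (complex.Re `|z|)%:C%C.
Proof. by rewrite normc_def. Qed.

(** Along the real segment from t0 to t1 the real and imaginary parts of phi
    are real functions with zero derivative. *)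
Lemma derive0_const_complex (phi : K -> K) (a r : K) :
  (forall t : K, ball a r t -> is_derive t 1 phi 0) ->
  forall t0 t1 : K, ball a r t0 -> ball a r t1 -> phi t0 = phi t1.
Proof.
move=> dphi t0 t1 b0 b1; pose d : C := t1 - t0.
pose p (u : R) : C := t0 + u%:C%C * d.
have pb (u : R) : 0 <= u <= 1 -> ball a r (p u).
  move=> /andP[u0 u1]; apply: (@ball_convex K) => //; first by rewrite ler0c.
  by rewrite -[1]/(1%:C%C) lecR.
have part (f : C -> R) : {morph f : x y / x - y} ->
    (forall z, `|f z|%:C%C <= `|z|) -> f (phi t0) = f (phi t1).
  move=> fB fle; pose m := complex.Re `|d|.
  have mE : `|d| = m%:C%C by exact: normC_real.
  have m0 : 0 <= m by rewrite -ler0c -mE.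
  have m1 : 0 < m + 1 by rewrite ltr_wpDl.
  have : f (phi (p 0)) = f (phi (p 1)).
    apply: (@derive0_segment _ (fun u => f (phi (p u)))) => // u u01.
    apply/is_derive_epsP => e e0.
    have e1 : 0 < (e / (m + 1))%:C%C by rewrite ltcR divr_gt0.
    have /is_derive_epsP/(_ _ e1)/near0_complexP[del del0 delP] :=
      dphi _ (pb _ u01).
    apply/nbhs_ballP; exists (del / (m + 1)); first by rewrite /= divr_gt0.
    move=> k; rewrite -ball_normE /= sub0r normrN ltr_pdivlMr // => kdel.
    have kd : `|k%:C%C * d| = (`|k| * m)%:C%C.
      by rewrite normrM mE normc_def /= expr0n addr0 sqrtr_sqr -rmorphM.
    have := delP (k%:C%C * d); rewrite kd ltcR mul0r subr0.
    have -> : k%:C%C * d + p u = p (k + u) by rewrite /p rmorphD; ring.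
    move=> /(_ _)/le_trans; rewrite mul0r subr0 -fB -lecR.
    have km : `|k| * m < del.
      by apply: le_lt_trans kdel; rewrite ler_wpM2l // lerDl.
    move=> /(_ _ km) H; apply: le_trans (fle _) _; apply: H.
    rewrite -rmorphM lecR.
    have -> : e / (m + 1) * (`|k| * m) = e * `|k| * (m / (m + 1)) by ring.
    by rewrite ler_piMr ?mulr_ge0 ?(ltW e0) // ler_pdivrMr // mul1r lerDl.
  have -> : p 0 = t0 by rewrite /p mul0r addr0.
  by have -> : p 1 = t1 by rewrite /p mul1r /d addrC subrK.
have re := part (@complex.Re R) (fun x y => _) norm_re_le.
have im := part (@complex.Im R) (fun x y => _) norm_im_le.
by apply/eqP; rewrite eq_complex re ?im ?eqxx // => -[? ?] [].
Qed.

Definition cexp z : C :=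
  (expR (complex.Re z) * cos (complex.Im z) +i*
   (expR (complex.Re z) * sin (complex.Im z)))%C.

Lemma cexp0 : cexp 0 = 1.
Proof. by rewrite /cexp /= expR0 cos0 sin0 mulr1 mulr0. Qed.

Lemma cexpD z w : cexp (z + w) = cexp z * cexp w.
Proof.
case: z w => [a b] [c d]; rewrite /cexp /= expRD cosD sinD.
by congr Complex; ring.
Qed.

Lemma unit_circle (c s : R) : c ^+ 2 + s ^+ 2 = 1 ->
  exists b, cos b = c /\ sin b = s.
Proof.
move=> cs; have c1 : -1 <= c <= 1.
  rewrite -ler_norml -(ler_pXn2r (n := 2)) ?nnegrE //.
  rewrite expr1n real_normK ?num_real //.
  by rewrite -cs lerDl sqr_ge0.
have sE : Num.sqrt (1 - c ^+ 2) = `|s|.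
  by rewrite -cs addrAC subrr add0r sqrtr_sqr.
have [s0|s0] := leP 0 s.
  exists (acos c); rewrite acosK ?in_itv //= sin_acos // sE ger0_norm //.
exists (- acos c); rewrite cosN sinN acosK ?in_itv //= sin_acos // sE.
by rewrite ltr0_norm // opprK.
Qed.

Lemma cexp_surj z : z != 0 -> exists u, cexp u = z.
Proof.
case: z => x y z0; pose m := Num.sqrt (x ^+ 2 + y ^+ 2).
have m2 : 0 < x ^+ 2 + y ^+ 2.
  rewrite lt0r addr_ge0 ?sqr_ge0 // andbT paddr_eq0 ?sqr_ge0 // !sqrf_eq0.
  by move: z0; rewrite eq_complex.
have m0 : 0 < m by rewrite sqrtr_gt0.
have mm : m ^+ 2 = x ^+ 2 + y ^+ 2 by rewrite sqr_sqrtr // ltW.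
have [|b [cb sb]] := @unit_circle (x / m) (y / m).
  by rewrite !expr_div_n -mulrDl -mm divff // expf_neq0 // gt_eqF.
exists (ln m +i* b)%C; rewrite /cexp /= lnK ?posrE // cb sb.
by rewrite !(mulrC m) !divfK ?gt_eqF.
Qed.

Lemma is_derive_eps_real (f : R -> R) (d e : R) :
  is_derive (0 : R) 1 f d -> 0 < e ->
  exists2 del : R, 0 < del &
    forall h, `|h| < del -> `|f h - f 0 - d * h| <= e * `|h|.
Proof.
move=> /is_derive_epsP/[apply]/nbhs_ballP[del /= del0 H].
exists del => // h hd; rewrite -{1}[h]addr0; apply: H.
by rewrite -ball_normE /= sub0r normrN.
Qed.

(** By additivity of the exponential this expansion at 0 is all that is needed
    for its derivative at every point. *)
Lemma cexp_expansion (e : R) : 0 < e -> exists2 del : R, 0 < del &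
  forall h, `|h| < del%:C%C -> `|cexp h - 1 - h| <= (e * complex.Re `|h|)%:C%C.
Proof.
(* The real and imaginary parts contribute errors 3 e' |h| and 5 e' |h|. *)
move=> e0.
have [e' [e'0 e'1 e'e]] : exists e' : R, [/\ 0 < e', e' <= 1 & 8 * e' <= e].
  exists (Num.min 1 (e / 8)); split; first by rewrite lt_min ltr01 divr_gt0.
    by rewrite ge_min lexx.
  by rewrite -ler_pdivlMl // mulrC ge_min lexx orbT.
have [d1 d10 expE] := is_derive_eps_real (is_derive_expR (0 : R)) e'0.
have [d2 d20 sinE] := is_derive_eps_real (is_derive_sin (0 : R)) e'0.
have [d3 d30 cosE] := is_derive_eps_real (is_derive_cos (0 : R)) e'0.
pose del := Num.min e' (Num.min d1 (Num.min d2 d3)).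
exists del; first by rewrite !lt_min e'0 d10 d20.
case=> a b; set H := complex.Re _; rewrite normC_real -/H ltcR !lt_min.
move=> /and4P[He H1 H2 H3].
have aH : `|a| <= H by rewrite -lecR -normC_real; exact: norm_re_le (a +i* b)%C.
have bH : `|b| <= H by rewrite -lecR -normC_real; exact: norm_im_le (a +i* b)%C.
have := expE a (le_lt_trans aH H1); rewrite expR0 mul1r => ea.
have := sinE b (le_lt_trans bH H2); rewrite sin0 subr0 cos0 mul1r => sb.
have := cosE b (le_lt_trans bH H3); rewrite sin0 oppr0 mul0r subr0 cos0 => cb.
apply: le_trans (norm_le_reim _) _; rewrite lecR /= subr0.
have H0 : 0 <= H by apply: le_trans aH.
have eH x : x <= H -> e' * x <= e' * H by move=> xH; rewrite ler_pM2l.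
have re : `|expR a * cos b - 1 - a| <= 3 * e' * H.
  have -> : expR a * cos b - 1 - a =
    (expR a - 1 - a) * cos b + (1 + a) * (cos b - 1) by ring.
  apply: le_trans (ler_normD _ _) _; rewrite !normrM.
  have -> : 3 * e' * H = e' * H * 1 + 2 * (e' * H) by ring.
  apply: lerD; apply: ler_pM => //; rewrite ?cos_max //.
  - exact: le_trans ea (eH _ aH).
  - apply: le_trans (ler_normD _ _) _; rewrite normr1 -[2]/(1 + 1) lerD2l.
    exact: le_trans aH (ltW (lt_le_trans He e'1)).
  - exact: le_trans cb (eH _ bH).
have im : `|expR a * sin b - b| <= 5 * e' * H.
  have -> : expR a * sin b - b = (expR a - 1) * sin b + (sin b - b) by ring.
  apply: le_trans (ler_normD _ _) _; rewrite normrM.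
  have -> : 5 * e' * H = 2 * e' * (2 * H) + e' * H by ring.
  have two (x y : R) : `|x - y| <= e' * `|y| -> `|y| <= H -> `|x| <= 2 * H.
    move=> xy yH; rewrite -[x](subrK y); apply: le_trans (ler_normD _ _) _.
    rewrite mulr_natl mulr2n lerD //; apply: le_trans xy _.
    by apply: le_trans yH; rewrite ler_piMl.
  apply: lerD; last exact: le_trans sb (eH _ bH).
  apply: ler_pM => //; last exact: two sb bH.
  have a2 := two _ _ ea aH.
  by apply: (le_trans a2); rewrite ler_pM2l // ltW.
apply: le_trans (lerD re im) _; rewrite -!mulrDl ler_wpM2r //.
by apply: le_trans e'e; rewrite -natrD.
Qed.

Lemma is_derive_cexp (u : K) : is_derive u 1 (cexp : K -> K) (cexp u).
Proof.
apply/is_derive_epsP => e e0.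
pose M := complex.Re `|cexp u|.
have ME : `|cexp u| = M%:C%C by exact: normC_real.
have M0 : 0 <= M by rewrite -ler0c -ME.
have M1 : 0 < M + 1 by rewrite ltr_wpDl.
have [eE e1] : e = (complex.Re e)%:C%C /\ 0 < complex.Re e.
  move: e0; rewrite ltcE /= => /andP[/eqP ei er]; split=> //.
  by case: e ei {er} => x y /= ->.
have [del del0 H] := cexp_expansion (divr_gt0 e1 M1).
apply/near0_complexP; exists del => // h /H{}H.
have -> : cexp (h + u) - cexp u - cexp u * h = cexp u * (cexp h - 1 - h).
  by rewrite cexpD; ring.
pose m := complex.Re `|h|; have hE : `|h| = m%:C%C by exact: normC_real.
have m0 : 0 <= m by rewrite -ler0c -hE.
rewrite normrM ME hE; rewrite -/m in H.
apply: le_trans (ler_wpM2l _ H) _; first by rewrite ler0c.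
rewrite eE -!rmorphM lecR.
have -> : M * (complex.Re e / (M + 1) * m) =
  complex.Re e * m * (M / (M + 1)) by ring.
by rewrite ler_piMr ?mulr_ge0 ?(ltW e1) // ler_pdivrMr // mul1r lerDl.
Qed.

End Complex.

(** * The manifold of positive points *)

Section PositivePoints.
Variables (R : realType) (Lam : zmodType) (n : nat).
Implicit Types (s t : seed Lam n) (x y : 'rV[R]_n).

Lemma positive_torus x : positive x -> torus x.
Proof. by move=> px i; rewrite gt_eqF. Qed.

Lemma positive_open : open (@positive R n).
Proof.
rewrite openE => x px; exists (fun i j => [set z : R | 0 < z]).
  move=> i j; apply: open_nbhs_nbhs; split; first exact: open_gt.
  by rewrite /= ord1; exact: px.
by move=> y py i; exact: py.
Qed.

Lemma positive_mono x c : positive x -> 0 < mono x c.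
Proof. by move=> px; apply: prodr_gt0 => i _; rewrite exprz_gt0. Qed.

Lemma positive_mut_dom s k x : positive x -> mut_dom s k x.
Proof. by move=> px i _; rewrite gt_eqF // addr_gt0 // exprz_gt0. Qed.

Lemma positive_mut_map s k x : positive x -> positive (mut_map s k x).
Proof.
move=> px i; rewrite mxE; case: ifP => _; first by rewrite invr_gt0.
by rewrite mulr_gt0 // exprz_gt0 // addr_gt0 // exprz_gt0.
Qed.

Lemma positive_iso_map s t (f : seed_iso s t) x :
  positive x -> positive (iso_map f x).
Proof. by move=> px i; rewrite mxE. Qed.

Lemma positive_path s t (c : cluster_path s t) x : positive x ->
  path_dom R c x /\ positive (path_map R c x).
Proof.
move=> px; elim: c => /= [|t' c [xc cx] k hk|t' u c [xc cx] f].
- by split=> //; exact: positive_torus.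
- by split; [split=> //; exact: positive_mut_dom | exact: positive_mut_map].
- by split=> //; exact: positive_iso_map.
Qed.

Lemma positive_path_surj s t (c : cluster_path s t) y : positive y ->
  exists2 x, positive x & path_map R c x = y.
Proof.
elim: c y => /= [y py|t' c IH k hk y py|t' u c IH f y py]; first by exists y.
- have pz : positive (mut_inv t' k y).
    move=> i; rewrite mxE mulr_gt0 ?mulr_gt0 // exprz_gt0 ?invr_gt0 //.
    by rewrite addr_gt0 // invr_gt0.
  have [x px xz] := IH _ pz; exists x => //.
  rewrite xz mut_invK //; first exact: positive_torus.
  by left; rewrite gt_eqF // addr_gt0 // invr_gt0.
- have [|x px xz] := IH (iso_inv f y); first by move=> i; rewrite mxE.
  by exists x; rewrite // xz iso_invK.
Qed.

Section Manifold.
Variable s : seed Lam n.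
Local Notation chart_pt := (@chart_point R Lam n s).

(** The coordinate of a positive point in the initial chart: it exists and is
    invariant under gluing, because cluster transformations are bijective on
    positive points. *)
Definition has_base (q : chart_pt) x : Prop :=
  positive x /\ path_map R (cp_path q) x = cp_coord q.

Lemma has_base_ex q : exists x, has_base q x.
Proof.
case: q => t c y py; have [x px xy] := positive_path_surj c py.
by exists x.
Qed.

Lemma glue_step_base q q' x : glue_step q q' -> has_base q x <-> has_base q' x.
Proof.
case=> [t c k hk y py py'|t u c f y py py']; rewrite /has_base /=.
  split=> -[px]; first by move=> ->.
  have [xc cx] := positive_path c px => xy; split=> //.
  rewrite -(mut_mapK hk (positive_torus cx)) ?xy ?mut_mapK //.
  - exact: positive_torus.
  - exact: positive_mut_dom.
  - exact: positive_mut_dom.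
split=> -[px]; first by move=> ->.
by move=> xy; split=> //; rewrite -(iso_mapK f (path_map R c x)) xy iso_mapK.
Qed.

Lemma glue_base q q' x : clos_refl_sym_trans _ (@glue_step R Lam n s) q q' ->
  has_base q x <-> has_base q' x.
Proof.
elim=> {q q'} [q q' /glue_step_base //|q //|q q' _ IH|p q r _ IH1 _ IH2].
  by rewrite IH.
by rewrite IH1 IH2.
Qed.

Lemma glue_from_base t (c : cluster_path s t) x (px : positive x)
    (py : positive (path_map R c x)) :
  clos_refl_sym_trans _ (@glue_step R Lam n s)
    (ChartPoint (cp_id s) px) (ChartPoint c py).
Proof.
elim: c py => /= [py|t' c IH k hk py|t' u c IH f py].
- by rewrite (Prop_irrelevance px py); exact: rst_refl.
- have [_ pz] := positive_path c px.
  apply: rst_trans (IH pz) _; apply: rst_step; exact: glue_mut.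
- have [_ pz] := positive_path c px.
  apply: rst_trans (IH pz) _; apply: rst_step; exact: glue_iso.
Qed.

Lemma X_class_eq (q q' : chart_pt) :
  X_class q = X_class q' <-> clos_refl_sym_trans _ (@glue_step R Lam n s) q q'.
Proof.
split=> [/(congr1 sval) /= qq'|qq'].
  have : glue_class q' q' by exact: rst_refl.
  by rewrite -qq'.
apply: eq_exist; apply/seteqP; split=> r /= h.
  by apply: rst_trans h; apply: rst_sym.
exact: rst_trans h.
Qed.

Lemma X_reprK (p : X_positive R s) : X_class (X_repr p) = p.
Proof.
rewrite /X_repr; case: cid => q /= pq; case: p pq => A hA /= AE.
by apply: eq_exist.
Qed.

(** Both the representative of p chosen in the definition of theta and the
    coordinate y are compared with the coordinate in the initial chart. *)
Lemma theta_positiveE (c : chart (X_positive_space R s)) p y a :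
  at_coord c p y -> KerL s a ->
  theta_positive p a = character (projT1 c) (path_lattice (projT2 c) a) y.
Proof.
case: c => t c [/= py pE] ak; rewrite /theta_positive.
have [x xb] := has_base_ex (X_repr p).
have baseE q : has_base q x ->
    character (cp_end q) (path_lattice (cp_path q) a) (cp_coord q) =
    character s a x.
  move=> [px <-]; have [xc _] := positive_path (cp_path q) px.
  by have [_ _ ->] := path_character xc.
rewrite (baseE _ xb) -(baseE (ChartPoint c py)) //.
have glued : clos_refl_sym_trans _ (@glue_step R Lam n s) (X_repr p)
    (ChartPoint c py).
  by apply/X_class_eq; rewrite X_reprK pE.
exact: (glue_base x glued).1 xb.
Qed.

Definition base_chart : chart (X_positive_space R s) := existT _ s (cp_id s).

Lemma base_chart_coord p : exists x, at_coord base_chart p x.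
Proof.
have [x [px xE]] := has_base_ex (X_repr p); exists x, px.
rewrite -[LHS]X_reprK; apply/X_class_eq/rst_sym.
case: (X_repr p) xE => t c y py /= xE; subst y.
exact: glue_from_base.
Qed.

Lemma flow_positive j x u : positive x -> positive (flow expR s j x u).
Proof. by move=> px i; rewrite mxE mulr_gt0 // expR_gt0. Qed.

(** A Hamiltonian curve may live in any chart, so invariance of theta is
    checked in all of them; but the initial chart covers the manifold, so that
    the chains of curves can be taken in that chart alone. *)
Lemma positive_leafE (p : X_positive R s) :
  [set q | clos_refl_trans _ (@ham_segment R n (X_positive_space R s)) p q] =
  theta_positive_fiber (theta_positive p).
Proof.
apply/seteqP; split=> [q|q qp] /=.
  elim=> {p q} [p q [c [U [f [a [r [g [_ Ut _ gU]]]]]]]|//|p q w _ pq _ qw] /=.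
    move=> [t0 [t1 [b0 b1 pc qc]]] b bk.
    rewrite (theta_positiveE pc bk) (theta_positiveE qc bk); symmetry.
    apply: (ham_segment_invariant (@derive0_const_real R) (c := c))
      gU b0 b1 _ => //.
    - by move=> v /Ut[p' [pv _]]; exact: positive_torus.
    - exact/path_KerL.
  by move=> b bk; rewrite qw ?pq.
have [x px] := base_chart_coord p; have [y py] := base_chart_coord q.
have [[posx _] [posy _]] := (px, py).
apply: (@fiber_chain _ expR _ _ _ _ _ _ (X_positive_space R s) base_chart
  (@positive R n) _ _ _ _ _ _ _ x y) => //.
- exact: expR0.
- exact: expRD.
- exact: positive_open.
- exact: positive_torus.
- by move=> v pv; exists (X_class (ChartPoint (cp_id s) pv)), pv.
- by move=> v p1 p2 [pv ->] [pv' ->]; rewrite (Prop_irrelevance pv pv').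
- by move=> j v u; exact: flow_positive.
- move=> v w d pv pw; exists (ln (mono (\row_i (w 0 i / v 0 i)) d)).
  by rewrite lnK // posrE positive_mono // => i; rewrite mxE divr_gt0.
- move=> a ak.
  by rewrite -(theta_positiveE px ak) -(theta_positiveE py ak) qp.
Qed.

Lemma positive_leafP (L : set (X_positive R s)) :
  symplectic_leaf (X_positive_space R s) L <->
  exists2 h : Lam -> R, H_positive s h & L = theta_positive_fiber h.
Proof.
split=> [[p [_ ->]]|[h [hh hpos] ->]].
  exists (theta_positive p); last exact: positive_leafE.
  have [x px] := base_chart_coord p; have [posx _] := px.
  have thE a : KerL s a -> theta_positive p a = character s a x.
    by move=> ak; rewrite (theta_positiveE px ak).
  split; last by move=> a ak; rewrite thE //; exact: positive_mono.
  split=> [a ak|a b ak bk].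
    by rewrite thE //; apply: mono_neq0; exact: positive_torus.
  rewrite !thE //; last exact: KerLD.
  by rewrite /character coordD; apply: monoD; exact: positive_torus.
have [x [[tx xh] xpos]] := theta_fiber_nonempty hh.
have posx : positive x by exact: xpos.
pose p : X_positive R s := X_class (ChartPoint (cp_id s) posx).
have px : at_coord base_chart p x by exists posx.
have pE a : KerL s a -> theta_positive p a = h a.
  by move=> ak; rewrite (theta_positiveE px ak) /= xh.
exists p; split; first by exists base_chart, x.
by rewrite positive_leafE; apply/seteqP; split=> q qh a ak; rewrite qh ?pE.
Qed.

End Manifold.
End PositivePoints.

Theorem proposition2p9 (R : realType) (Lam : zmodType) (n : nat)
    (s : seed Lam n) :
  (* a) The fibers of theta over the complex points of H are the symplectic
     leaves of the torus attached to s. *)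
  (forall L : set 'rV[R[i]]_n,
     symplectic_leaf (torus_space R[i] s) L <->
     exists2 h : Lam -> R[i], H_point s h & L = theta_fiber s h) /\
  (* The tangent spaces of a fiber consist of the Hamiltonian vectors. *)
  (forall (h : Lam -> R[i]) (x v : 'rV[R[i]]_n),
     H_point s h -> theta_fiber s h x ->
     fiber_tangent s x v <-> (v <= seed_bivec s x)%MS) /\
  (* Cluster transformations induce birational isomorphisms between fibers that
     respect the symplectic structures. *)
  (forall (t : seed Lam n) (c : cluster_path s t) (h h' : Lam -> R[i]),
     H_point s h -> H_point t h' ->
     (forall a, KerL s a -> h' (path_lattice c a) = h a) ->
     fiber_birational c h h' /\ fiber_symplectic c h) /\
  (* b) The fibers over the positive points of H are the symplectic leaves of
     the manifold of positive points. *)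
  (forall L : set (X_positive R s),
     symplectic_leaf (X_positive_space R s) L <->
     exists2 h : Lam -> R, H_positive s h & L = theta_positive_fiber h).
Proof.
pose dcexp := @is_derive_cexp R.
split; last split; last split.
- move=> L; apply: (torus_leafP (cexp0 R) (@cexpD R) dcexp).
    exact: derive0_const_complex.
  exact: cexp_surj.
- by move=> h x v _ [tx _]; exact: fiber_tangentP.
- move=> t c h h' _ _ hh'; split; last exact: fiber_symplectic_path.
  exact: (fiber_birational_path (cexp0 R) (@cexpD R) dcexp).
- by move=> L; exact: positive_leafP.
Qed.
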